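(* Let $(A,\mathcal D,\psi)$ be an entwining structure over $k$ and let $\mathcal C=A\otimes_k\mathcal D$ be the associated $A$-coring. Then $(A,\mathcal D,\psi)$ is a cleft entwining structure if and only if $A$ (with the right regular $A$-module structure) is a cleft bicomodule for the pure coring extension $\mathcal D$ of $\mathcal C$.
   Context: Fix a commutative ring $k$; all algebras are associative unital $k$-algebras. Entwining structures. An entwining structure consists of a $k$-algebra $A$, a $k$-coalgebra $\mathcal D$ (coproduct $d\mapsto d_{(1)}\otimes d_{(2)}$, counit $\epsilon_{\mathcal D}$) and a $k$-linear map $\psi:\mathcal D\otimes_kA\to A\otimes_k\mathcal D$, $d\otimes a\mapsto a_\psi\otimes d^\psi$ (implicit summation), with $\psi\circ(\mathcal D\otimes\mu_A)=(\mu_A\otimes\mathcal D)(A\otimes\psi)(\psi\otimes A)$, $\psi(d\otimes1_A)=1_A\otimes d$, $(A\otimes\Delta_{\mathcal D})\circ\psi=(\psi\otimes\mathcal D)(\mathcal D\otimes\psi)(\Delta_{\mathcal D}\otimes A)$, $(A\otimes\epsilon_{\mathcal D})\circ\psi=\epsilon_{\mathcal D}\otimes A$ (tensor products over $k$, $\mu_A$ the multiplication). The associated $A$-coring is $\mathcal C=A\otimes_k\mathcal D$ with left multiplication, right action $(a\otimes d)a'=aa'_\psi\otimes d^\psi$, coproduct $A\otimes_k\Delta_{\mathcal D}$ and counit $A\otimes_k\epsilon_{\mathcal D}$. The $k$-coring $\mathcal D$ is a pure right extension of $\mathcal C$ via the right $\mathcal D$-coaction $A\otimes_k\Delta_{\mathcal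 D}$ on $\mathcal C$. Right $\mathcal C$-comodules are the same as entwined modules: right $A$-modules and right $\mathcal D$-comodules $M$ (coaction $m\mapsto m_{[0]}\otimes_km_{[1]}$) with $(ma)_{[0]}\otimes(ma)_{[1]}=m_{[0]}a_\psi\otimes {m_{[1]}}^\psi$; the induced $\mathcal D$-comodule structure of a $\mathcal C$-comodule is this one. Cleft entwining structures. $(A,\mathcal D,\psi)$ is cleft if $A$, with the right regular $A$-module structure, is an entwined module (i.e. carries a right $\mathcal D$-coaction making it so) and there is a right $\mathcal D$-colinear map $\lambda:\mathcal D\to A$ which is convolution invertible, i.e. invertible in $\mathrm{Hom}_k(\mathcal D,A)$ with product $(fg)(d)=f(d_{(1)})g(d_{(2)})$ and unit $\epsilon_{\mathcal D}(-)1_A$. Cleft bicomodules. Let $\mathcal C$ be any $A$-coring (coproduct $c\mapsto c^{(1)}\otimes_Ac^{(2)}$, right coactions $m\mapsto m^{[0]}\otimes_Am^{[1]}$) having the $k$-coalgebra $\mathcal D$ as a pure right extension with left $\mathcal C$-colinear coaction $c\mapsto c_{[0]}\otimes_kc_{[1]}$; then any right $\mathcal C$-comodule $M$ is a right $\mathcal D$-comodule via $m\mapsto m^{[0]}\epsilon_{\mathcal C}({m^{[1]}}_{[0]})\otimes_k{m^{[1]}}_{[1]}$. For a right $\mathcal C$-comodule $\Sigma$ (i.e. $k$-$\mathcal C$ bicomodule) put $T=\mathrm{End}^{\mathcal C}(\Sigma)$, $\Sigma^*=\mathrm{Hom}_A(\Sigma,A)$ and $$\widetilde Q=\{q\in{}_A\mathrm{Hom}(\mathcal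 C,\Sigma^* )\mid c^{(1)}q(c^{(2)})(x)=q(c)(x^{[0]})x^{[1]}\ \forall x\in\Sigma,c\in\mathcal C\}.$$ For $p\in\mathrm{Hom}^{\mathcal D}(\mathcal D,\Sigma)$ and $q\in\widetilde Q$ put $(q\bullet p)(c)=q(c_{[0]})\big(p(c_{[1]})^{[0]}\big)p(c_{[1]})^{[1]}$ and $(p\lozenge q)(d)=p(d)^{[0]}q(p(d)^{[1]})(-)\in T$. $\Sigma$ is a cleft bicomodule for the extension if there exist $j\in\mathrm{Hom}^{\mathcal D}(\mathcal D,\Sigma)$, $\tilde\jmath\in\widetilde Q$ with $\tilde\jmath\bullet j=\mathrm{id}_{\mathcal C}$ and $j\lozenge\tilde\jmath=\epsilon_{\mathcal D}(-)1_T$. That ''$A$ (with the right regular $A$-module structure) is a cleft bicomodule'' means that the right regular $A$-module $A$ carries a right $\mathcal C$-coaction for which it is a cleft bicomodule; the coaction is the same on both sides of the equivalence. *)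

(* Defs.v *)
From HB Require Import structures.
From mathcomp Require Import all_boot all_order all_algebra.
From mathcomp Require Import generic_quotient.
From mathcomp Require Import boolp.

Set Implicit Arguments.
Unset Strict Implicit.
Unset Printing Implicit Defensive.

Import GRing.Theory.
Local Open Scope ring_scope.
Local Open Scope quotient_scope.

(* Associative unital algebras.  The library's algType is not used because it
   excludes the zero algebra. *)
Record algebra (k : pzRingType) := MkAlgebra {
  alg_ring : pzRingType;
  alg_lmod : GRing.Nmodule_isLSemiModule k alg_ring;
  alg_scalerAl : forall (c : k) (x y : alg_ring),
    GRing.Nmodule_isLSemiModule.scale alg_lmod c (x * y) =
    GRing.Nmodule_isLSemiModule.scale alg_lmod c x * y;
  alg_scalerAr : forall (c : k) (x y : alg_ring),
    GRing.Nmodule_isLSemiModule.scale alg_lmod c (x * y) =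
    x * GRing.Nmodule_isLSemiModule.scale alg_lmod c y
}.

Definition alg_sort (k : pzRingType) (A : algebra k) : Type := alg_ring A.
Coercion alg_sort : algebra >-> Sortclass.

HB.instance Definition _ (k : pzRingType) (A : algebra k) :=
  GRing.PzRing.copy (alg_sort A) (alg_ring A).
HB.instance Definition _ (k : pzRingType) (A : algebra k) :
    GRing.Nmodule_isLSemiModule k (alg_sort A) := alg_lmod A.

Lemma algZAl (k : pzRingType) (A : algebra k) (c : k) (x y : A) :
  c *: (x * y) = (c *: x) * y.
Proof. exact: alg_scalerAl. Qed.
Lemma algZAr (k : pzRingType) (A : algebra k) (c : k) (x y : A) :
  c *: (x * y) = x * (c *: y).
Proof. exact: alg_scalerAr. Qed.

Definition alg_of_algType (k : pzRingType) (A : algType k) : algebra k :=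
  @MkAlgebra k A _ (@GRing.scalerAl k A) (@GRing.scalerAr k A).

Lemma regular_scalerAr (k : comPzRingType) (c x y : k^o) :
  c *: (x * y) = x * (c *: y).
Proof. by rewrite /GRing.scale /= mulrCA. Qed.

Definition base_alg (k : comPzRingType) : algebra k :=
  @MkAlgebra k k^o _ (@mulrA k) (@regular_scalerAr k).

Section Modules.
Variable k : comPzRingType.

Record rightMod (A : algebra k) := RightMod {
  rmod_sort :> lmodType k;
  ract : rmod_sort -> A -> rmod_sort;
  ract_linearl : forall a, linear (ract^~ a);
  ract_linearr : forall m, linear (ract m);
  ract1 : forall m, ract m 1 = m;
  ractA : forall m a b, ract (ract m a) b = ract m (a * b)
}.

Record leftMod (A : algebra k) := LeftMod {
  lmod_sort :> lmodType k;
  lact : A -> lmod_sort -> lmod_sort;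
  lact_linearl : forall m, linear (lact^~ m);
  lact_linearr : forall a, linear (lact a);
  lact1 : forall m, lact 1 m = m;
  lactA : forall a b m, lact a (lact b m) = lact (a * b) m
}.

Record biMod (A B : algebra k) := BiMod {
  bi_right :> rightMod B;
  blact : A -> bi_right -> bi_right;
  blact_linearl : forall m, linear (blact^~ m);
  blact_linearr : forall a, linear (blact a);
  blact1 : forall m, blact 1 m = m;
  blactA : forall a b m, blact a (blact b m) = blact (a * b) m;
  blact_ract : forall a m b, blact a (ract m b) = ract (blact a m) b
}.

Definition bi_left A B (M : biMod A B) : leftMod A :=
  LeftMod (@blact_linearl _ _ M) (@blact_linearr _ _ M)
    (@blact1 _ _ M) (@blactA _ _ M).
Coercion bi_left : biMod >-> leftMod.
Canonical bi_left.

End Modules.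

Arguments ract {k A} _ _ _ : rename.
Arguments lact {k A} _ _ _ : rename.
Arguments blact {k A B} _ _ _ : rename.

Notation "m ◃ a" := (ract _ m a)
  (at level 40, left associativity) : ring_scope.
Notation "a ▹ m" := (lact _ a m)
  (at level 40, left associativity) : ring_scope.

Section Tensor.
Variables (k : comPzRingType) (A : algebra k).
Variables (M : rightMod A) (N : leftMod A).

(* A list [:: (m1, n1); ...; (mr, nr)] stands for the formal sum of the
   mi ⊗ ni; tens_eq is the congruence defining the tensor product of M and N
   over A.  No formal differences are needed, as - (m ⊗ n) = (- m) ⊗ n. *)
Inductive tens_eq : seq (M * N) -> seq (M * N) -> Prop :=
| teq_refl s : tens_eq s s
| teq_sym s t : tens_eq s t -> tens_eq t s
| teq_trans s t u : tens_eq s t -> tens_eq t u -> tens_eq s u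
| teq_cat s s' t t' : tens_eq s s' -> tens_eq t t' ->
    tens_eq (s ++ t) (s' ++ t')
| teq_catC s t : tens_eq (s ++ t) (t ++ s)
| teq_zero n : tens_eq [:: (0, n)] [::]
| teq_addl m m' n : tens_eq [:: (m + m', n)] [:: (m, n); (m', n)]
| teq_addr m n n' : tens_eq [:: (m, n + n')] [:: (m, n); (m, n')]
| teq_balance m a n : tens_eq [:: (m ◃ a, n)] [:: (m, a ▹ n)].

Definition tens_eqb : rel (seq (M * N)) := fun s t => `[< tens_eq s t >].

Lemma tens_eqb_refl : reflexive tens_eqb.
Proof. by move=> s; apply/asboolP; apply: teq_refl. Qed.
Lemma tens_eqb_sym : symmetric tens_eqb.
Proof. by move=> s t; apply/asboolP/asboolP; apply: teq_sym. Qed.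
Lemma tens_eqb_trans : transitive tens_eqb.
Proof.
by move=> s t u /asboolP st /asboolP su; apply/asboolP; apply: teq_trans su.
Qed.

Canonical tens_equiv := EquivRel tens_eqb
  tens_eqb_refl tens_eqb_sym tens_eqb_trans.

Definition tens : Type := {eq_quot tens_equiv}.
HB.instance Definition _ := Choice.on tens.
HB.instance Definition _ := EqQuotient.on tens.

Lemma tens_piP s t : \pi_tens s = \pi_tens t <-> tens_eq s t.
Proof.
split=> [/eqmodP /asboolP //|st]; apply/eqmodP; exact/asboolP.
Qed.

Lemma tens_repr s : tens_eq (repr (\pi_tens s)) s.
Proof. by apply/tens_piP; rewrite reprK. Qed.

Lemma tens_piE (x : tens) : exists s, x = \pi_tens s.
Proof. by exists (repr x); rewrite reprK. Qed.

Definition tens_scale_seq (c : k) : seq (M * N) -> seq (M * N) :=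
  map (fun p => (c *: p.1, p.2)).

Lemma ract_scale (m : M) (a : A) (c : k) : (c *: m) ◃ a = c *: (m ◃ a).
Proof.
have e0 : (0 : M) ◃ a = 0.
  have /(_ 1 0 0) := ract_linearl (r:=M) a.
  by rewrite !scale1r addr0 => /esym/(canRL (addrK _)); rewrite subrr.
by have /(_ c m 0) := ract_linearl (r:=M) a; rewrite !addr0 e0 addr0.
Qed.

Lemma tens_scale_seqP c s t :
  tens_eq s t -> tens_eq (tens_scale_seq c s) (tens_scale_seq c t).
Proof.
elim=> {s t} /=.
- by move=> s; apply: teq_refl.
- by move=> s t _; apply: teq_sym.
- by move=> s t u _ st _; apply: teq_trans.
- by move=> s s' t t' _ ss _ tt; rewrite /tens_scale_seq !map_cat; apply: teq_cat.
- by move=> s t; rewrite /tens_scale_seq !map_cat; apply: teq_catC.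
- by move=> n; rewrite scaler0; apply: teq_zero.
- by move=> m m' n; rewrite scalerDr; apply: teq_addl.
- by move=> m n n'; apply: teq_addr.
- by move=> m a n; rewrite -ract_scale; apply: teq_balance.
Qed.

Definition tens_add (s t : tens) : tens := \pi_tens (repr s ++ repr t).
Definition tens_zero : tens := \pi_tens [::].
Definition tens_opp (s : tens) : tens := \pi_tens (tens_scale_seq (- 1) (repr s)).
Definition tens_scale (c : k) (s : tens) : tens :=
  \pi_tens (tens_scale_seq c (repr s)).

Lemma tens_add_pi s t : tens_add (\pi_tens s) (\pi_tens t) = \pi_tens (s ++ t).
Proof. by apply/tens_piP; apply: teq_cat; apply: tens_repr. Qed.
Lemma tens_scale_pi c s : tens_scale c (\pi_tens s) = \pi_tens (tens_scale_seq c s).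
Proof. by apply/tens_piP; apply: tens_scale_seqP; apply: tens_repr. Qed.

Lemma tens_addA : associative tens_add.
Proof.
move=> x y z; have [s ->] := tens_piE x; have [t ->] := tens_piE y.
have [u ->] := tens_piE z; by rewrite !tens_add_pi catA.
Qed.
Lemma tens_addC : commutative tens_add.
Proof.
move=> x y; have [s ->] := tens_piE x; have [t ->] := tens_piE y.
rewrite !tens_add_pi.
by apply/tens_piP; apply: teq_catC.
Qed.
Lemma tens_add0 : left_id tens_zero tens_add.
Proof. by move=> x; have [s ->] := tens_piE x; rewrite tens_add_pi. Qed.
Lemma tens_addN : left_inverse tens_zero tens_opp tens_add.
Proof.
move=> x; have [s ->] := tens_piE x.
rewrite -[tens_opp _]/(tens_scale (-1) _).
rewrite tens_scale_pi tens_add_pi.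
elim: s => [|[m n] r IH] //=.
have IHeq : tens_eq (tens_scale_seq (-1) r ++ r) [::] by apply/tens_piP.
apply/tens_piP.
have e1 : tens_eq ((-1 *: m, n) :: (tens_scale_seq (-1) r ++ (m, n) :: r))
  ([:: (-1 *: m, n)] ++ ([:: (m, n)] ++ r ++ tens_scale_seq (-1) r)).
  apply: (@teq_cat [:: _] [:: _]); first exact: teq_refl.
  exact: (teq_catC _ ((m, n) :: r)).
apply: teq_trans e1 _; rewrite [X in tens_eq X _](catA [:: _]).
apply: (@teq_trans _ ([::] ++ [::])); last exact: teq_refl.
apply: teq_cat; last exact: teq_trans (teq_catC _ _) IHeq.
apply: teq_trans (teq_sym (teq_addl _ _ _)) _.
by rewrite scaleN1r addNr; apply: teq_zero.
Qed.

HB.instance Definition _ :=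
  GRing.isZmodule.Build tens tens_addA tens_addC tens_add0 tens_addN.

Lemma tens_addE (s t : tens) : s + t = tens_add s t. Proof. by []. Qed.

Lemma tens_scaleA a b v : tens_scale a (tens_scale b v) = tens_scale (a * b) v.
Proof.
have [s ->] := tens_piE v.
rewrite !tens_scale_pi /tens_scale_seq -map_comp.
by congr (\pi_tens _); apply: eq_map => p /=; rewrite scalerA.
Qed.
Lemma tens_scale1 : left_id 1 tens_scale.
Proof.
move=> v; have [s ->] := tens_piE v; rewrite tens_scale_pi /tens_scale_seq.
congr (\pi_tens _); rewrite -[RHS]map_id; apply: eq_map => -[m n] /=.
by rewrite scale1r.
Qed.
Lemma tens_scaleDr : right_distributive tens_scale +%R.
Proof.
move=> a u v; rewrite !tens_addE.
have [s ->] := tens_piE u; have [t ->] := tens_piE v; by rewrite tens_add_pi !tens_scale_pi tens_add_pi /tens_scale_seq map_cat.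
Qed.
Lemma tens_scaleDl v : {morph tens_scale^~ v : a b / a + b}.
Proof.
move=> a b; rewrite !tens_addE; have [s ->] := tens_piE v; rewrite !tens_scale_pi tens_add_pi.
elim: s => [|[m n] r IH] //=.
have {}IH : tens_eq (tens_scale_seq (a + b) r)
    (tens_scale_seq a r ++ tens_scale_seq b r) by apply/tens_piP.
apply/tens_piP => /=; rewrite scalerDl.
apply: (@teq_trans _ ([:: (a *: m, n); (b *: m, n)] ++
    (tens_scale_seq a r ++ tens_scale_seq b r))).
  by apply: (@teq_cat [:: _]); [apply: teq_addl|].
rewrite -[X in tens_eq X _]/([:: (a *: m, n)] ++
  ([:: (b *: m, n)] ++ tens_scale_seq a r ++ tens_scale_seq b r)).
rewrite -[X in tens_eq _ X]/([:: (a *: m, n)] ++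
  (tens_scale_seq a r ++ [:: (b *: m, n)] ++ tens_scale_seq b r)).
apply: teq_cat; first exact: teq_refl.
by rewrite !catA; apply: teq_cat; [apply: teq_catC|apply: teq_refl].
Qed.

HB.instance Definition _ := GRing.Zmodule_isLmodule.Build k tens
  tens_scaleA tens_scale1 tens_scaleDr tens_scaleDl.

Lemma tens_scaleE c (s : tens) : c *: s = tens_scale c s. Proof. by []. Qed.

Definition tpure (m : M) (n : N) : tens := \pi_tens [:: (m, n)].

(* tlift t f = \sum_i f mi ni for a chosen decomposition t = \sum_i mi ⊗ ni;
   it does not depend on the decomposition as soon as f is balanced. *)
Definition tlift (P : zmodType) (t : tens) (f : M -> N -> P) : P :=
  \sum_(p <- repr t) f p.1 p.2.

Definition balanced (P : zmodType) (f : M -> N -> P) : Prop :=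
  [/\ forall n, {morph f^~ n : m m' / m + m'},
      forall m, {morph f m : n n' / n + n'}
    & forall m a n, f (m ◃ a) n = f m (a ▹ n)].

End Tensor.

Notation "m ⊗ n" := (tpure m n)
  (at level 40, left associativity) : ring_scope.
Notation "M ⊗ N" := (tens M N)
  (at level 40, left associativity) : type_scope.

(* Sweedler notation: \tsum_(x ⊗ y <- t) F is F with t written x ⊗ y. *)
Notation "\tsum_ ( x ⊗ y <- t ) F" := (tlift t (fun x y => F))
  (at level 41, F at level 41, x name, y name, t at level 200,
   format "\tsum_ ( x  ⊗  y  <-  t )  F") : ring_scope.

Section TensorTheory.
Variables (k : comPzRingType) (A : algebra k).
Variables (M : rightMod A) (N : leftMod A).
Local Notation T := (tens M N).

Lemma addm0 (U V : zmodType) (g : U -> V) :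
  {morph g : x y / x + y} -> g 0 = 0.
Proof. by move=> gD; apply: (@addrI _ (g 0)); rewrite -gD !addr0. Qed.

Lemma addm_sum (U V : zmodType) (g : U -> V) I (r : seq I) F :
  {morph g : x y / x + y} -> g (\sum_(i <- r) F i) = \sum_(i <- r) g (F i).
Proof. by move=> gD; apply: big_morph => //; apply: addm0. Qed.

Lemma tpureDl (m m' : M) (n : N) : (m + m') ⊗ n = m ⊗ n + m' ⊗ n.
Proof. by rewrite tens_addE tens_add_pi; apply/tens_piP/teq_addl. Qed.
Lemma tpureDr (m : M) (n n' : N) : m ⊗ (n + n') = m ⊗ n + m ⊗ n'.
Proof. by rewrite tens_addE tens_add_pi; apply/tens_piP/teq_addr. Qed.
Lemma tpureA (m : M) a (n : N) : (m ◃ a) ⊗ n = m ⊗ (a ▹ n).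
Proof. exact/tens_piP/teq_balance. Qed.
Lemma tpureZl c (m : M) (n : N) : (c *: m) ⊗ n = c *: (m ⊗ n).
Proof. by rewrite tens_scaleE tens_scale_pi. Qed.

Lemma balanced_tpure : balanced (@tpure _ _ M N).
Proof.
by split=> [n m m'|m n n'|m a n]; [apply: tpureDl|apply: tpureDr|apply: tpureA].
Qed.

Lemma tlift_morph (P Q : zmodType) (g : P -> Q) (f : M -> N -> P) (t : T) :
  {morph g : x y / x + y} ->
  g (\tsum_(x ⊗ y <- t) f x y) = \tsum_(x ⊗ y <- t) g (f x y).
Proof. exact: addm_sum. Qed.

Lemma eq_tlift (P : zmodType) (f g : M -> N -> P) (t : T) :
  (forall x y, f x y = g x y) ->
  \tsum_(x ⊗ y <- t) f x y = \tsum_(x ⊗ y <- t) g x y.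
Proof. by move=> fg; apply: eq_bigr => p _. Qed.

Lemma tliftDf (P : zmodType) (f g : M -> N -> P) (t : T) :
  \tsum_(x ⊗ y <- t) (f x y + g x y) =
  \tsum_(x ⊗ y <- t) f x y + \tsum_(x ⊗ y <- t) g x y.
Proof. exact: big_split. Qed.

Lemma tens_pi_sum s :
  \pi_(tens M N) s = \sum_(p <- s) (p.1 ⊗ p.2).
Proof.
elim: s => [|[m n] s IH]; first by rewrite big_nil.
by rewrite big_cons -IH tens_addE /tpure tens_add_pi.
Qed.

Lemma tensE (t : T) : t = \tsum_(x ⊗ y <- t) (x ⊗ y).
Proof. by rewrite -{1}(reprK t) tens_pi_sum. Qed.

Section Balanced.
Variables (P : zmodType) (f : M -> N -> P).
Hypothesis fB : balanced f.

Lemma tens_eq_sum s t : tens_eq s t ->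
  \sum_(p <- s) f p.1 p.2 = \sum_(p <- t) f p.1 p.2.
Proof.
case: fB => fl fr fa; elim=> {s t} //.
- by move=> s t u _ -> _ ->.
- by move=> s s' t t' _ e _ e'; rewrite !big_cat e e'.
- by move=> s t; rewrite !big_cat /= addrC.
- by move=> n; rewrite big_seq1 big_nil /=; apply: addm0 (fl n).
- by move=> m m' n; rewrite !big_cons !big_nil /= !addr0 fl.
- by move=> m n n'; rewrite !big_cons !big_nil /= !addr0 fr.
- by move=> m a n; rewrite !big_seq1 /= fa.
Qed.

Lemma tlift_pi s : tlift (\pi_(tens M N) s) f = \sum_(p <- s) f p.1 p.2.
Proof. exact/tens_eq_sum/tens_repr. Qed.

Lemma tlift_pure m n : \tsum_(x ⊗ y <- m ⊗ n) f x y = f m n.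
Proof. by rewrite tlift_pi big_seq1. Qed.

Lemma tliftD : {morph (fun t => tlift t f) : s t / s + t}.
Proof.
move=> x y /=; rewrite tens_addE; have [s ->] := tens_piE x.
have [t ->] := tens_piE y; rewrite tens_add_pi !tlift_pi.
by rewrite big_cat.
Qed.

End Balanced.

Lemma tliftZ (P : lmodType k) (f : M -> N -> P) : balanced f ->
  (forall c m n, f (c *: m) n = c *: f m n) ->
  forall c t, tlift (c *: t) f = c *: tlift t f.
Proof.
move=> fB fZ c x; have [t ->] := tens_piE x; rewrite tens_scaleE tens_scale_pi !tlift_pi //.
rewrite scaler_sumr /tens_scale_seq big_map; apply: eq_bigr => p _.
exact: fZ.
Qed.

Lemma tlift_linear (P : lmodType k) (f : M -> N -> P) : balanced f ->
  (forall c m n, f (c *: m) n = c *: f m n) -> linear (fun t => tlift t f).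
Proof. by move=> fB fZ c s t /=; rewrite tliftD // tliftZ. Qed.

Lemma tens_ext (P : zmodType) (g h : T -> P) :
  {morph g : x y / x + y} -> {morph h : x y / x + y} ->
  (forall m n, g (m ⊗ n) = h (m ⊗ n)) -> g =1 h.
Proof.
move=> gD hD gh t; rewrite (tensE t) !tlift_morph //.
exact: eq_tlift.
Qed.

End TensorTheory.

Section Helpers.
Variable k : comPzRingType.

Lemma linear_addm (U V : lmodType k) (g : U -> V) :
  linear g -> {morph g : x y / x + y}.
Proof. by move=> gL x y; have := gL 1 x y; rewrite !scale1r. Qed.

Lemma linear_scalem (U V : lmodType k) (g : U -> V) :
  linear g -> forall c x, g (c *: x) = c *: g x.
Proof.
move=> gL c x; have := gL c x 0; rewrite !addr0 => ->.
by rewrite (addm0 (linear_addm gL)) addr0.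
Qed.

Lemma linearm (U V : lmodType k) (g : U -> V) : {morph g : x y / x + y} ->
  (forall c x, g (c *: x) = c *: g x) -> linear g.
Proof. by move=> gD gZ c x y; rewrite gD gZ. Qed.

Variables (A : algebra k) (M : rightMod A) (N : leftMod A).

Lemma ractDl (m m' : M) a : (m + m') ◃ a = m ◃ a + m' ◃ a.
Proof. exact: linear_addm (ract_linearl (r := M) a) m m'. Qed.
Lemma ractDr (m : M) a b : m ◃ (a + b) = m ◃ a + m ◃ b.
Proof. exact: linear_addm (ract_linearr m) a b. Qed.
Lemma ractZl c (m : M) a : (c *: m) ◃ a = c *: (m ◃ a).
Proof. exact: linear_scalem (ract_linearl (r := M) a) c m. Qed.
Lemma ractZr (m : M) c a : m ◃ (c *: a) = c *: (m ◃ a).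
Proof. exact: linear_scalem (ract_linearr m) c a. Qed.
Lemma lactDl a b (n : N) : (a + b) ▹ n = a ▹ n + b ▹ n.
Proof. exact: linear_addm (lact_linearl n) a b. Qed.
Lemma lactDr a (n n' : N) : a ▹ (n + n') = a ▹ n + a ▹ n'.
Proof. exact: linear_addm (lact_linearr (l := N) a) n n'. Qed.
Lemma lactZl c a (n : N) : (c *: a) ▹ n = c *: (a ▹ n).
Proof. exact: linear_scalem (lact_linearl n) c a. Qed.
Lemma lactZr a c (n : N) : a ▹ (c *: n) = c *: (a ▹ n).
Proof. exact: linear_scalem (lact_linearr (l := N) a) c n. Qed.

Lemma tpureZr c (m : M) (n : N) : m ⊗ (c *: n) = c *: (m ⊗ n).
Proof.
rewrite -tpureZl -[n in LHS]lact1 -lactZl -tpureA ractZr ract1.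
by [].
Qed.

Lemma balanced_morph (P Q : zmodType) (g : P -> Q) (f : M -> N -> P) :
  {morph g : x y / x + y} -> balanced f -> balanced (fun m n => g (f m n)).
Proof.
move=> gD [fl fr fa]; split=> [n m m'|m n n'|m a n] /=.
- by rewrite fl gD.
- by rewrite fr gD.
- by rewrite fa.
Qed.

End Helpers.

Section OverBase.
Variable k : comPzRingType.

Section OneModule.
Variable V : lmodType k.
Definition kact (v : V) (c : base_alg k) : V := (c : k) *: v.

Lemma kact_linearl c : linear (kact^~ c).
Proof.
by move=> d u v; rewrite /kact scalerDr !scalerA mulrC.
Qed.
Lemma kact_linearr v : linear (kact v).
Proof. by move=> d a b; rewrite /kact scalerDl -scalerA. Qed.
Lemma kact1 v : kact v 1 = v.
Proof. exact: scale1r. Qed.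
Lemma kactA v a b : kact (kact v a) b = kact v (a * b).
Proof. by rewrite /kact scalerA mulrC. Qed.
Lemma kactA' a b v : kact (kact v b) a = kact v (a * b).
Proof. by rewrite /kact scalerA. Qed.

(* A k-module seen as a module over the k-algebra k. *)
Definition kright : rightMod (base_alg k) :=
  RightMod kact_linearl kact_linearr kact1 kactA.
Definition kleft : leftMod (base_alg k) :=
  @LeftMod k (base_alg k) V (fun c v => kact v c)
    kact_linearr kact_linearl kact1 kactA'.

End OneModule.

(* A left A-module seen as an (A, k)-bimodule. *)
Definition kbi (A : algebra k) (M : leftMod A) : biMod A (base_alg k).
Proof.
refine (@BiMod k A (base_alg k) (kright M) (@lact _ _ M)
  (@lact_linearl _ _ M) (@lact_linearr _ _ M)
  (@lact1 _ _ M) (@lactA _ _ M) _).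
by move=> a m c; apply: lactZr.
Defined.

Section RegularModules.
Variable A : algebra k.

Lemma alg_mul_linearl (b : A) : linear (fun a : A => a * b).
Proof. by move=> c x y; rewrite mulrDl -algZAl. Qed.
Lemma alg_mul_linearr (a : A) : linear (fun b : A => a * b).
Proof. by move=> c x y; rewrite mulrDr -algZAr. Qed.

Definition rregular : rightMod A :=
  @RightMod k A A (fun a b => a * b) alg_mul_linearl alg_mul_linearr
    (@mulr1 _) (fun a b c => esym (mulrA a b c)).
Definition lregular : leftMod A :=
  @LeftMod k A A (fun a b => a * b) alg_mul_linearl alg_mul_linearr
    (@mul1r _) (fun a b c => mulrA a b c).

End RegularModules.
End OverBase.

Notation "V ⊗k W" := (tens (kright V) (kleft W))
  (at level 40, left associativity) : type_scope.
Notation "v ⊗k w" := (@tpure _ (base_alg _) (kright _) (kleft _) v w)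
  (at level 40, left associativity) : ring_scope.

Section LeftTensor.
Variables (k : comPzRingType) (A B : algebra k).
Variables (M : biMod A B) (N : leftMod B).

Definition ltens_act (a : A) (t : M ⊗ N) : M ⊗ N :=
  \tsum_(m ⊗ n <- t) (blact M a m ⊗ n).

Let blactDl (a b : A) (m : M) : blact M (a + b) m = blact M a m + blact M b m.
Proof. exact: linear_addm (blact_linearl m) a b. Qed.
Let blactDr (a : A) (m m' : M) : blact M a (m + m') = blact M a m + blact M a m'.
Proof. exact: linear_addm (@blact_linearr _ _ _ M a) m m'. Qed.
Let blactZl c (a : A) (m : M) : blact M (c *: a) m = c *: blact M a m.
Proof. exact: linear_scalem (blact_linearl m) c a. Qed.
Let blactZr c (a : A) (m : M) : blact M a (c *: m) = c *: blact M a m.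
Proof. exact: linear_scalem (@blact_linearr _ _ _ M a) c m. Qed.

Lemma ltens_balanced (a : A) :
  balanced (fun (m : M) (n : N) => blact M a m ⊗ n).
Proof.
split=> [n m m'|m n n'|m b n] /=.
- by rewrite blactDr tpureDl.
- by rewrite tpureDr.
- by rewrite blact_ract tpureA.
Qed.

Lemma ltens_act_pure a (m : M) (n : N) :
  ltens_act a (m ⊗ n) = blact M a m ⊗ n.
Proof. exact: (tlift_pure (ltens_balanced a)). Qed.

Lemma ltens_act_linearr a : linear (ltens_act a).
Proof.
apply: tlift_linear; first exact: ltens_balanced.
by move=> c m n; rewrite blactZr tpureZl.
Qed.
Let actD a := linear_addm (ltens_act_linearr a).

Lemma ltens_act_linearl t : linear (ltens_act^~ t).
Proof.
move=> c a b; move: t; apply: tens_ext => [|x y|m n] /=.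
- exact: actD.
- by rewrite !actD scalerDr addrACA.
- by rewrite !ltens_act_pure blactDl blactZl tpureDl tpureZl.
Qed.

Lemma ltens_act1 t : ltens_act 1 t = t.
Proof.
move: t; apply: tens_ext => [|//|m n]; first exact: actD.
by rewrite ltens_act_pure blact1.
Qed.

Lemma ltens_actA a b t : ltens_act a (ltens_act b t) = ltens_act (a * b) t.
Proof.
move: t; apply: tens_ext => [x y||m n]; [by rewrite !actD|exact: actD|].
by rewrite !ltens_act_pure blactA.
Qed.

Definition ltens : leftMod A :=
  LeftMod ltens_act_linearl ltens_act_linearr ltens_act1 ltens_actA.

End LeftTensor.

Canonical ltens.

Section Coalgebras.
Variable k : comPzRingType.

Record coalgebra := Coalgebra {
  coalg_sort :> lmodType k;
  comul : {linear coalg_sort -> (coalg_sort ⊗k coalg_sort)%type};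
  counit : {scalar coalg_sort};
  comulA : forall d : coalg_sort,
    \tsum_(x ⊗ y <- comul d) \tsum_(x1 ⊗ x2 <- comul x) x1 ⊗k (x2 ⊗k y) =
    \tsum_(x ⊗ y <- comul d) x ⊗k comul y;
  counitl : forall d : coalg_sort, \tsum_(x ⊗ y <- comul d) counit x *: y = d;
  counitr : forall d : coalg_sort, \tsum_(x ⊗ y <- comul d) counit y *: x = d
}.

Record dcomod (D : coalgebra) (M : lmodType k) := DComod {
  dcoact :> {linear M -> (M ⊗k D)%type};
  dcoactA : forall m : M,
    \tsum_(x ⊗ d <- dcoact m) \tsum_(x1 ⊗ x2 <- dcoact x) x1 ⊗k (x2 ⊗k d) =
    \tsum_(x ⊗ d <- dcoact m) x ⊗k comul D d;
  dcoact_counit : forall m : M,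
    \tsum_(x ⊗ d <- dcoact m) counit D d *: x = m
}.

Definition colinear_from (D : coalgebra) (M : lmodType k)
    (rho : M -> M ⊗k D) (f : D -> M) : Prop :=
  forall d, rho (f d) = \tsum_(x ⊗ y <- comul D d) f x ⊗k y.

End Coalgebras.

Arguments comul {k} _.
Arguments counit {k} _.

Section Corings.
Variables (k : comPzRingType) (A : algebra k).

Record coring := Coring {
  coring_bimod :> biMod A A;
  ccomul : {linear coring_bimod -> (coring_bimod ⊗ coring_bimod)%type};
  ccounit : {linear coring_bimod -> A};
  ccomul_lact : forall (a : A) (c : coring_bimod),
    ccomul (a ▹ c) = \tsum_(x ⊗ y <- ccomul c) (a ▹ x) ⊗ y;
  ccomul_ract : forall (c : coring_bimod) (a : A),
    ccomul (c ◃ a) = \tsum_(x ⊗ y <- ccomul c) x ⊗ (y ◃ a);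
  ccounit_lact : forall (a : A) (c : coring_bimod),
    ccounit (a ▹ c) = a * ccounit c;
  ccounit_ract : forall (c : coring_bimod) (a : A),
    ccounit (c ◃ a) = ccounit c * a;
  ccomulA : forall c : coring_bimod,
    \tsum_(x ⊗ y <- ccomul c) \tsum_(x1 ⊗ x2 <- ccomul x) x1 ⊗ (x2 ⊗ y) =
    \tsum_(x ⊗ y <- ccomul c) x ⊗ ccomul y;
  ccounitl : forall c : coring_bimod,
    \tsum_(x ⊗ y <- ccomul c) (ccounit x ▹ y) = c;
  ccounitr : forall c : coring_bimod,
    \tsum_(x ⊗ y <- ccomul c) (x ◃ ccounit y) = c
}.

Record ccomod (C : coring) (M : rightMod A) := CComod {
  ccoact :> {linear M -> (M ⊗ C)%type};
  ccoact_ract : forall (m : M) (a : A),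
    ccoact (m ◃ a) = \tsum_(x ⊗ c <- ccoact m) x ⊗ (c ◃ a);
  ccoactA : forall m : M,
    \tsum_(x ⊗ c <- ccoact m) \tsum_(x1 ⊗ x2 <- ccoact x) x1 ⊗ (x2 ⊗ c) =
    \tsum_(x ⊗ c <- ccoact m) x ⊗ ccomul C c;
  ccoact_counit : forall m : M,
    \tsum_(x ⊗ c <- ccoact m) (x ◃ ccounit C c) = m
}.

(* Over the commutative ring k every right extension is pure: for a right
   C-comodule M the fork M -> M ⊗_A C => M ⊗_A C ⊗_A C is split by the k-linear
   maps M ⊗ ccounit and M ⊗ C ⊗ ccounit, so - ⊗k W preserves it for all W. *)
Record right_extension (C : coring) (D : coalgebra k) := RightExtension {
  ext_coact :> dcomod D C;
  ext_lact : forall (a : A) (c : C),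
    ext_coact (a ▹ c) = \tsum_(x ⊗ d <- ext_coact c) (a ▹ x) ⊗k d;
  ext_colinear : forall c : C,
    \tsum_(x ⊗ d <- ext_coact c) \tsum_(x1 ⊗ x2 <- ccomul C x)
      x1 ⊗ (x2 ⊗k d : ltens (kbi C) (kleft D)) =
    \tsum_(x ⊗ y <- ccomul C c) x ⊗ (ext_coact y : ltens (kbi C) (kleft D))
}.

End Corings.

Arguments ccomul {k A} _.
Arguments ccounit {k A} _.

Section CleftBicomodules.
Variables (k : comPzRingType) (A : algebra k).
Variables (C : coring A) (D : coalgebra k) (K : right_extension C D).
Variables (S : rightMod A) (rho : ccomod C S).

Definition induced_coact (x : S) : S ⊗k D :=
  \tsum_(x0 ⊗ x1 <- rho x) \tsum_(c ⊗ d <- K x1) (x0 ◃ ccounit C c) ⊗k d.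

(* An element of Q-tilde is a left A-linear map from C to Hom_A(S, A), with
   (a f)(x) = a f(x), written in uncurried form. *)
Record Qtilde := MkQtilde {
  qfun :> C -> S -> A;
  qfun_linearl : forall x : S, linear (qfun^~ x);
  qfun_linearr : forall c : C, linear (qfun c);
  qfun_ract : forall (c : C) (x : S) (a : A),
    qfun c (x ◃ a) = qfun c x * a;
  qfun_lact : forall (a : A) (c : C) (x : S),
    qfun (a ▹ c) x = a * qfun c x;
  qfun_comul : forall (c : C) (x : S),
    \tsum_(c1 ⊗ c2 <- ccomul C c) (c1 ◃ qfun c2 x) =
    \tsum_(x0 ⊗ x1 <- rho x) (qfun c x0 ▹ x1)
}.

Definition qbullet (q : Qtilde) (p : D -> S) (c : C) : C :=
  \tsum_(c0 ⊗ d <- K c) \tsum_(x0 ⊗ x1 <- rho (p d)) (q c0 x0 ▹ x1).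

Definition lozenge (p : D -> S) (q : Qtilde) (d : D) (x : S) : S :=
  \tsum_(x0 ⊗ x1 <- rho (p d)) (x0 ◃ q x1 x).

(* Elements of T = End^C(S). *)
Record comod_end := ComodEnd {
  comod_endfun :> {linear S -> S};
  comod_end_ract : forall (x : S) (a : A),
    comod_endfun (x ◃ a) = comod_endfun x ◃ a;
  comod_end_coact : forall x : S,
    rho (comod_endfun x) = \tsum_(x0 ⊗ x1 <- rho x) comod_endfun x0 ⊗ x1
}.

End CleftBicomodules.

Section MoreTensor.
Variables (k : comPzRingType).

Lemma tlift_tlift (A B : algebra k) (M : rightMod A) (N : leftMod A)
    (M' : rightMod B) (N' : leftMod B) (P : zmodType)
    (t : M ⊗ N) (h : M -> N -> M' ⊗ N') (f : M' -> N' -> P) : balanced f ->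
  tlift (tlift t h) f = \tsum_(x ⊗ y <- t) tlift (h x y) f.
Proof. by move=> fB; apply: (tlift_morph (g := fun u => tlift u f)); apply: tliftD. Qed.

Lemma exchange_tlift (A B : algebra k) (M : rightMod A) (N : leftMod A)
    (M' : rightMod B) (N' : leftMod B) (P : zmodType)
    (t : M ⊗ N) (u : M' ⊗ N') (f : M -> N -> M' -> N' -> P) :
  \tsum_(x ⊗ y <- t) \tsum_(z ⊗ w <- u) f x y z w =
  \tsum_(z ⊗ w <- u) \tsum_(x ⊗ y <- t) f x y z w.
Proof. exact: exchange_big. Qed.

Lemma balanced_inner (A B : algebra k) (M : rightMod A) (N : leftMod A)
    (M' : rightMod B) (N' : leftMod B) (P : zmodType)
    (t : M ⊗ N) (f : M -> N -> M' -> N' -> P) :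
  (forall x y, balanced (f x y)) ->
  balanced (fun z w => \tsum_(x ⊗ y <- t) f x y z w).
Proof.
move=> fB; split=> [n m m'|m n n'|m a n] /=.
- by rewrite -tliftDf; apply: eq_tlift => x y; case: (fB x y) => ->.
- by rewrite -tliftDf; apply: eq_tlift => x y; case: (fB x y) => _ ->.
- by apply: eq_tlift => x y; case: (fB x y) => _ _ ->.
Qed.

Lemma linear_inner (A : algebra k) (M : rightMod A) (N : leftMod A)
    (U V : lmodType k) (t : M ⊗ N) (f : M -> N -> U -> V) :
  (forall x y, linear (f x y)) ->
  linear (fun u => \tsum_(x ⊗ y <- t) f x y u).
Proof.
move=> fL c u v; rewrite (tlift_morph (g := fun z => c *: z)); last first.
  exact: scalerDr.
by rewrite -tliftDf; apply: eq_tlift => x y; rewrite fL.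
Qed.

Lemma linear_comp (U V W : lmodType k) (g : V -> W) (f : U -> V) :
  linear g -> linear f -> linear (fun u => g (f u)).
Proof. by move=> gL fL c x y; rewrite fL gL. Qed.

Lemma linear_of (U V : lmodType k) (f : {linear U -> V}) : linear f.
Proof. exact: linearP. Qed.

Definition bilin (U V W : lmodType k) (f : U -> V -> W) : Prop :=
  (forall v, linear (f^~ v)) /\ (forall u, linear (f u)).

Section Bilin.
Variables (U V W : lmodType k) (f : U -> V -> W).
Hypothesis fB : bilin f.

Lemma bilin_balanced : @balanced k _ (kright U) (kleft V) W f.
Proof.
case: fB => fl fr; split=> [n m m'|m n n'|m a n] /=.
- exact: linear_addm (fl n) m m'.
- exact: linear_addm (fr m) n n'.
- rewrite /kact (linear_scalem (fl n)) (linear_scalem (fr m)).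
  by [].
Qed.

Lemma ktlift_pure u v : tlift (u ⊗k v) f = f u v.
Proof. exact: tlift_pure bilin_balanced _ _. Qed.

Lemma ktlift_linear :
  linear (fun t : (U ⊗k V)%type => @tlift _ _ (kright U) (kleft V) _ t f).
Proof.
apply: tlift_linear; first exact: bilin_balanced.
by move=> c u v; case: fB => fl _; rewrite (linear_scalem (fl v)).
Qed.

End Bilin.

Lemma linear_tpurel (A : algebra k) (M : rightMod A) (N : leftMod A) (n : N) :
  linear (fun m : M => m ⊗ n).
Proof. by move=> c x y; rewrite tpureDl tpureZl. Qed.
Lemma linear_tpurer (A : algebra k) (M : rightMod A) (N : leftMod A) (m : M) :
  linear (fun n : N => m ⊗ n).
Proof. by move=> c x y; rewrite tpureDr tpureZr. Qed.

Lemma bilin_ktpure (U V : lmodType k) :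
  bilin (fun (u : U) (v : V) => u ⊗k v).
Proof.
split=> [v|u]; [exact: (@linear_tpurel _ (kright U) (kleft V))|].
exact: (@linear_tpurer _ (kright U) (kleft V)).
Qed.

Lemma balanced_tmapr (A : algebra k) (M : rightMod A) (N N' : leftMod A)
    (g : N -> N') : {morph g : x y / x + y} ->
  (forall a n, g (a ▹ n) = a ▹ g n) ->
  balanced (fun (m : M) (n : N) => m ⊗ g n).
Proof.
move=> gD gA; split=> [n m m'|m n n'|m a n] /=.
- exact: tpureDl.
- by rewrite gD tpureDr.
- by rewrite gA tpureA.
Qed.

End MoreTensor.

Section LozengeEnd.
Variables (k : comPzRingType) (A : algebra k).
Variables (C : coring A) (D : coalgebra k).
Variables (S : rightMod A) (rho : ccomod C S).
Variables (p : D -> S) (q : Qtilde rho) (d : D).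

Lemma lozenge_linear : linear (lozenge p q d).
Proof.
apply: linear_inner => x0 x1; apply: linear_comp; first exact: ract_linearr.
exact: qfun_linearr.
Qed.

Lemma lozenge_ract x a : lozenge p q d (x ◃ a) = lozenge p q d x ◃ a.
Proof.
rewrite /lozenge (tlift_morph (g := fun z => z ◃ a)); last exact/linear_addm/ract_linearl.
by apply: eq_tlift => x0 x1; rewrite qfun_ract ractA.
Qed.

Lemma lozenge_coact x :
  rho (lozenge p q d x) = \tsum_(x0 ⊗ x1 <- rho x) lozenge p q d x0 ⊗ x1.
Proof.
have psiB : balanced (fun (y1 : C) (x1 : C) => y1 ◃ q x1 x).
  split=> [n m m'|m n n'|m a n] /=; first exact: ractDl.
    by rewrite (linear_addm (@qfun_linearl _ _ _ _ _ q x)) ractDr.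
  by rewrite (ractA m) -qfun_lact.
pose Psi (w : ltens C C) : C := \tsum_(y1 ⊗ x1 <- w) (y1 ◃ q x1 x).
have PsiD : {morph Psi : u v / u + v} by apply: tliftD.
have PsiA a w : Psi (a ▹ w) = a ▹ Psi w.
  move: w; apply: tens_ext => [u v|u v|y1 x1] /=.
  - by rewrite (lactDr (N := ltens C C)) PsiD.
  - by rewrite PsiD (lactDr (N := C)).
  - rewrite [_ ▹ (_ ⊗ _)]ltens_act_pure /Psi !(tlift_pure psiB).
    by rewrite [RHS]blact_ract.
have PhiB := @balanced_tmapr _ _ S _ (C : leftMod A) Psi PsiD PsiA.
rewrite /lozenge (tlift_morph (g := rho)); last exact: raddfD.
transitivity (tlift (\tsum_(x0 ⊗ c <- rho (p d)) \tsum_(y0 ⊗ y1 <- rho x0)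
    y0 ⊗ (y1 ⊗ c : ltens C C)) (fun y0 w => y0 ⊗ (Psi w : (C : leftMod A)))).
  rewrite tlift_tlift //; apply: eq_tlift => x0 c.
  rewrite tlift_tlift // ccoact_ract; apply: eq_tlift => y0 y1.
  by rewrite (tlift_pure PhiB) /Psi (tlift_pure psiB).
rewrite ccoactA tlift_tlift //.
transitivity (\tsum_(x0 ⊗ x1 <- rho (p d)) \tsum_(z0 ⊗ z1 <- rho x)
   (x0 ◃ q x1 z0) ⊗ z1).
  apply: eq_tlift => x0 x1; rewrite (tlift_pure PhiB) /Psi qfun_comul.
  rewrite (tlift_morph (g := fun z : (C : leftMod A) => x0 ⊗ z)); last exact: tpureDr.
  by apply: eq_tlift => z0 z1; rewrite tpureA.
rewrite exchange_tlift; apply: eq_tlift => z0 z1.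
by rewrite (tlift_morph (g := fun z : S => z ⊗ z1)) // => u v; apply: tpureDl.
Qed.

Definition lozenge_lin : {linear S -> S} :=
  HB.pack (lozenge p q d) (GRing.isLinear.Build k S S *:%R _ lozenge_linear).

Definition lozenge_end : comod_end rho :=
  @ComodEnd k A C S rho lozenge_lin lozenge_ract lozenge_coact.

End LozengeEnd.

Section CleftBicomodule.
Variables (k : comPzRingType) (A : algebra k).
Variables (C : coring A) (D : coalgebra k) (K : right_extension C D).

Definition cleft_bicomodule (S : rightMod A) (rho : ccomod C S) : Prop :=
  exists (j : {linear D -> S}) (jt : Qtilde rho),
    [/\ colinear_from (induced_coact K rho) j,
        forall c : C, qbullet K jt j c = c
      & forall (d : D) (x : S), lozenge_end j jt d x = counit D d *: x].

Definition regular_cleft_bicomodule : Prop :=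
  exists rho : ccomod C (rregular A), cleft_bicomodule rho.

End CleftBicomodule.

Section Entwining.
Variables (k : comPzRingType) (A : algebra k) (D : coalgebra k).

Record entwining := Entwining {
  entw_map :> {linear (D ⊗k A)%type -> (A ⊗k D)%type};
  entw_mul : forall (d : D) (a b : A),
    entw_map (d ⊗k (a * b)) =
    \tsum_(a' ⊗ d' <- entw_map (d ⊗k a))
      \tsum_(b' ⊗ d'' <- entw_map (d' ⊗k b)) (a' * b') ⊗k d'';
  entw_one : forall d : D, entw_map (d ⊗k (1 : A)) = (1 : A) ⊗k d;
  entw_comul : forall (d : D) (a : A),
    \tsum_(a' ⊗ d' <- entw_map (d ⊗k a)) a' ⊗k comul D d' =
    \tsum_(d1 ⊗ d2 <- comul D d) \tsum_(a' ⊗ d2' <- entw_map (d2 ⊗k a))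
      \tsum_(a'' ⊗ d1' <- entw_map (d1 ⊗k a')) a'' ⊗k (d1' ⊗k d2');
  entw_counit : forall (d : D) (a : A),
    \tsum_(a' ⊗ d' <- entw_map (d ⊗k a)) counit D d' *: a' = counit D d *: a
}.

Variable psi : entwining.

Let mulL (x : A) : linear (fun y : A => x * y) := alg_mul_linearr x.
Let mulR (y : A) : linear (fun x : A => x * y) := alg_mul_linearl y.

Definition entw_ract_pure (x : A) (d : D) (a : A) : A ⊗k D :=
  \tsum_(a' ⊗ d' <- psi (d ⊗k a)) (x * a') ⊗k d'.

Definition entw_ract (c : A ⊗k D) (a : A) : A ⊗k D :=
  \tsum_(x ⊗ d <- c) entw_ract_pure x d a.

Let pureB (x : A) : bilin (fun (a' : A) (d' : D) => (x * a') ⊗k d').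
Proof.
split=> [d'|a']; last exact: (bilin_ktpure A D).2.
exact: (linear_comp ((bilin_ktpure A D).1 d') (mulL x)).
Qed.

Let ract_pure_x d a : linear (fun x => entw_ract_pure x d a).
Proof.
apply: linear_inner => a' d'.
exact: (linear_comp ((bilin_ktpure A D).1 d') (mulR a')).
Qed.
Let ract_pure_d x a : linear (fun d => entw_ract_pure x d a).
Proof.
apply: (linear_comp (ktlift_linear (pureB x))).
apply: (linear_comp (linear_of psi)); exact: (bilin_ktpure D A).1.
Qed.
Let ract_pure_a x d : linear (fun a => entw_ract_pure x d a).
Proof.
apply: (linear_comp (ktlift_linear (pureB x))).
apply: (linear_comp (linear_of psi)); exact: (bilin_ktpure D A).2.
Qed.
Let ractB a : bilin (fun x d => entw_ract_pure x d a).
Proof. by split=> [d|x]; [apply: ract_pure_x|apply: ract_pure_d]. Qed.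

Lemma entw_ractE x d a : entw_ract (x ⊗k d) a = entw_ract_pure x d a.
Proof. exact: (ktlift_pure (ractB a)). Qed.
Lemma entw_ract_linearl a : linear (fun c => entw_ract c a).
Proof. exact: (ktlift_linear (ractB a)). Qed.
Lemma entw_ract_linearr c : linear (fun a => entw_ract c a).
Proof. by apply: linear_inner => x d; apply: ract_pure_a. Qed.
Let ractD a := linear_addm (entw_ract_linearl a).

Lemma entw_ract1 c : entw_ract c 1 = c.
Proof.
move: c; apply: tens_ext => [||x d]; [exact: ractD|by []|].
rewrite entw_ractE /entw_ract_pure entw_one (ktlift_pure (pureB x)) mulr1.
by [].
Qed.

Lemma entw_ractA c a b : entw_ract (entw_ract c a) b = entw_ract c (a * b).
Proof.
move: c; apply: tens_ext => [u v||x d]; [by rewrite !ractD|exact: ractD|].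
rewrite !entw_ractE {1}/entw_ract_pure (tlift_morph (g := fun z => entw_ract z b)) //.
rewrite /entw_ract_pure entw_mul tlift_tlift; last exact: bilin_balanced.
apply: eq_tlift => a' d'; rewrite tlift_tlift; last exact: bilin_balanced.
rewrite entw_ractE; apply: eq_tlift => b' d''.
by rewrite (ktlift_pure (pureB x)) mulrA.
Qed.

Definition AD_left : leftMod A := ltens (kbi (lregular A)) (kleft D).

Definition entw_right : rightMod A :=
  @RightMod k A (A ⊗k D)%type entw_ract
    entw_ract_linearl entw_ract_linearr entw_ract1 entw_ractA.

Lemma AD_lactE a x d : lact AD_left a (x ⊗k d) = (a * x) ⊗k d.
Proof. exact: (@ltens_act_pure _ _ _ (kbi (lregular A)) (kleft D)). Qed.

Lemma entw_lact_ract a (c : entw_right) b :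
  lact AD_left a (c ◃ b) = entw_ract (lact AD_left a c) b.
Proof.
have lD := lactDr (N := AD_left) a.
move: c; apply: tens_ext => [u v|u v|x d].
- by rewrite ractDl lD.
- by rewrite lD ractD.
rewrite AD_lactE entw_ractE /= entw_ractE /entw_ract_pure.
rewrite (tlift_morph (g := lact AD_left a)) //.
by apply: eq_tlift => a' d'; rewrite AD_lactE mulrA.
Qed.

Definition entw_bimod : biMod A A :=
  @BiMod k A A entw_right (lact AD_left)
    (@lact_linearl _ _ AD_left) (@lact_linearr _ _ AD_left)
    (@lact1 _ _ AD_left) (@lactA _ _ AD_left) entw_lact_ract.

Local Notation C := entw_bimod.
Local Notation tC := (fun (x : A) (d : D) => (x ⊗k d : entw_bimod)).

Lemma C_lactE a x d : a ▹ tC x d = tC (a * x) d.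
Proof. exact: AD_lactE. Qed.
Lemma C_ractE x d a :
  tC x d ◃ a = \tsum_(a' ⊗ d' <- psi (d ⊗k a)) tC (x * a') d'.
Proof. exact: entw_ractE. Qed.
Let tC_x d : linear (fun x => tC x d). Proof. exact: (bilin_ktpure A D).1. Qed.
Let tC_d x : linear (tC x). Proof. exact: (bilin_ktpure A D).2. Qed.
Lemma tC_split x d : tC x d = x ▹ tC 1 d.
Proof. by rewrite C_lactE mulr1. Qed.

Definition entw_comul_pure (x : A) (d : D) : C ⊗ C :=
  \tsum_(d1 ⊗ d2 <- comul D d) tC x d1 ⊗ tC 1 d2.
Definition entw_ccomul_fun (c : C) : C ⊗ C :=
  \tsum_(x ⊗ d <- c) entw_comul_pure x d.

Let dd_bilin (x : A) : bilin (fun d1 d2 : D => tC x d1 ⊗ tC 1 d2).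
Proof.
split=> [d2|d1].
  exact: (linear_comp (@linear_tpurel _ _ C C (tC 1 d2)) (tC_d x)).
exact: (linear_comp (@linear_tpurer _ _ C C (tC x d1)) (tC_d 1)).
Qed.
Let comul_pureB : bilin entw_comul_pure.
Proof.
split=> [d|x].
  apply: linear_inner => d1 d2.
  exact: (linear_comp (@linear_tpurel _ _ C C (tC 1 d2)) (tC_x d1)).
exact: (linear_comp (ktlift_linear (dd_bilin x)) (linear_of (comul D))).
Qed.
Lemma entw_ccomul_linear : linear entw_ccomul_fun.
Proof. exact: (ktlift_linear comul_pureB). Qed.
Let comulD := linear_addm entw_ccomul_linear.
Lemma entw_ccomulE x d : entw_ccomul_fun (tC x d) = entw_comul_pure x d.
Proof. exact: (ktlift_pure comul_pureB). Qed.
Definition entw_ccomul : {linear C -> (C ⊗ C)%type} :=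
  HB.pack entw_ccomul_fun
    (GRing.isLinear.Build k C (C ⊗ C)%type *:%R _ entw_ccomul_linear).

Definition entw_ccounit_fun (c : C) : A :=
  \tsum_(x ⊗ d <- c) counit D d *: x.
Let epsB : bilin (fun (x : A) (d : D) => counit D d *: x).
Proof.
split=> [d|x] c u v.
  by rewrite scalerDr !scalerA mulrC.
by rewrite linearP scalerDl scalerA.
Qed.
Lemma entw_ccounit_linear : linear entw_ccounit_fun.
Proof. exact: (ktlift_linear epsB). Qed.
Let epsD := linear_addm entw_ccounit_linear.
Lemma entw_ccounitE x d : entw_ccounit_fun (tC x d) = counit D d *: x.
Proof. exact: (ktlift_pure epsB). Qed.
Definition entw_ccounit : {linear C -> A} :=
  HB.pack entw_ccounit_fun
    (GRing.isLinear.Build k C A *:%R _ entw_ccounit_linear).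

Let CC_lactB a : balanced (fun (x y : C) => (a ▹ x) ⊗ y) := @ltens_balanced k A A C C a.

Lemma entw_ccomul_lact a (c : C) :
  entw_ccomul (a ▹ c) = \tsum_(x ⊗ y <- entw_ccomul c) (a ▹ x) ⊗ y.
Proof.
move: c; apply: (tens_ext (M := kright A) (N := kleft D)) => [u v|u v|x d].
- by rewrite (lactDr (N := C)); apply: comulD.
- rewrite (comulD u v : entw_ccomul (u + v) = _).
  exact: (tliftD (CC_lactB a)).
rewrite [_ ▹ _]C_lactE [LHS]entw_ccomulE [X in tlift X]entw_ccomulE.
rewrite /entw_comul_pure tlift_tlift; last exact: CC_lactB.
by apply: eq_tlift => d1 d2; rewrite (tlift_pure (CC_lactB a)) C_lactE.
Qed.

Let CC_ractB a : balanced (fun (x y : C) => x ⊗ (y ◃ a)).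
Proof.
apply: (@balanced_tmapr _ _ C C C (fun y : C => y ◃ a)) => [x y|b y].
  exact: (ractDl (M := C)).
by rewrite [RHS]blact_ract.
Qed.

Lemma entw_ccomul_ract (c : C) a :
  entw_ccomul (c ◃ a) = \tsum_(x ⊗ y <- entw_ccomul c) x ⊗ (y ◃ a).
Proof.
move: c; apply: (tens_ext (M := kright A) (N := kleft D)) => [u v|u v|x d].
- by rewrite (ractDl (M := C)); apply: comulD.
- rewrite (comulD u v : entw_ccomul (u + v) = _).
  exact: (tliftD (CC_ractB a)).
rewrite [X in tlift X]entw_ccomulE [X in entw_ccomul X]C_ractE.
rewrite (tlift_morph (g := entw_ccomul)); last exact: comulD.
pose G (y : A) (w : (D ⊗k D)%type) : C ⊗ C :=
  @tlift _ _ (kright D) (kleft D) _ w (fun d1 d2 => tC (x * y) d1 ⊗ tC 1 d2).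
have GB : bilin G.
  split=> [w|y]; last exact: (ktlift_linear (dd_bilin _)).
  apply: linear_inner => d1 d2.
  apply: (linear_comp (@linear_tpurel _ _ C C (tC 1 d2))).
  exact: (linear_comp (tC_x d1) (mulL x)).
transitivity (tlift (\tsum_(a' ⊗ d' <- psi (d ⊗k a)) a' ⊗k comul D d') G).
  rewrite tlift_tlift; last exact: bilin_balanced.
  by apply: eq_tlift => a' d'; rewrite (ktlift_pure GB) [LHS]entw_ccomulE.
rewrite entw_comul tlift_tlift; last exact: bilin_balanced.
rewrite /entw_comul_pure tlift_tlift; last exact: CC_ractB.
apply: eq_tlift => d1 d2; rewrite (tlift_pure (CC_ractB a)) C_ractE.
rewrite (tlift_morph (g := fun z : C => tC x d1 ⊗ z)); last exact: tpureDr.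
rewrite tlift_tlift; last exact: bilin_balanced.
apply: eq_tlift => a' d2'; rewrite tlift_tlift; last exact: bilin_balanced.
rewrite mul1r (tC_split a' d2') -(tpureA (N := C)) C_ractE.
rewrite (tlift_morph (g := fun z : C => z ⊗ tC 1 d2')); last first.
  by move=> u v; apply: tpureDl.
apply: eq_tlift => a'' d1'.
by rewrite (ktlift_pure GB) /G (ktlift_pure (dd_bilin _)).
Qed.

Lemma entw_ccounit_lact a (c : C) :
  entw_ccounit (a ▹ c) = a * entw_ccounit c.
Proof.
move: c; apply: (tens_ext (M := kright A) (N := kleft D)) => [u v|u v|x d].
- by rewrite (lactDr (N := C)); apply: epsD.
- by rewrite (epsD u v : entw_ccounit (u + v) = _) mulrDr.
by rewrite [_ ▹ _]C_lactE [LHS]entw_ccounitE [X in _ = _ * X]entw_ccounitE algZAr.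
Qed.

Lemma entw_ccounit_ract (c : C) a :
  entw_ccounit (c ◃ a) = entw_ccounit c * a.
Proof.
move: c; apply: (tens_ext (M := kright A) (N := kleft D)) => [u v|u v|x d].
- by rewrite (ractDl (M := C)); apply: epsD.
- by rewrite (epsD u v : entw_ccounit (u + v) = _) mulrDl.
rewrite [_ ◃ _]C_ractE [X in _ = X * _]entw_ccounitE.
rewrite (tlift_morph (g := entw_ccounit)); last exact: epsD.
rewrite -algZAl algZAr -(entw_counit psi).
rewrite (tlift_morph (g := fun y => x * y)); last exact: mulrDr.
by apply: eq_tlift => a' d'; rewrite [LHS]entw_ccounitE algZAr.
Qed.

Lemma entw_ccomulA (c : C) :
  \tsum_(x ⊗ y <- entw_ccomul c) \tsum_(x1 ⊗ x2 <- entw_ccomul x)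
     x1 ⊗ (x2 ⊗ y) =
  \tsum_(x ⊗ y <- entw_ccomul c) x ⊗ entw_ccomul y.
Proof.
pose L1 (y : C) (x1 x2 : C) : C ⊗ ltens C C := x1 ⊗ (x2 ⊗ y).
have L1B y : balanced (L1 y).
  apply: (@balanced_tmapr _ _ C C (ltens C C) (fun x2 : C => x2 ⊗ y)) => [u v|b u].
    exact: tpureDl.
  by rewrite [RHS]ltens_act_pure.
pose L (x y : C) := tlift (entw_ccomul x) (L1 y).
have LB : balanced L.
  split=> [n m m'|m n n'|m a n]; cbv beta; rewrite /L.
  - by rewrite (comulD m m' : entw_ccomul (m + m') = _) (tliftD (L1B n)).
  - rewrite -tliftDf; apply: eq_tlift => x1 x2.
    by rewrite /L1 (tpureDr (N := C)) (tpureDr (N := ltens C C)).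
  - rewrite entw_ccomul_ract tlift_tlift //; apply: eq_tlift => x1 x2.
    by rewrite (tlift_pure (L1B n)) /L1 (tpureA (N := C)).
have RB : balanced (fun x y : C => x ⊗ (entw_ccomul y : ltens C C)).
  apply: (@balanced_tmapr _ _ C C (ltens C C) entw_ccomul) => [u v|b u].
    exact: comulD.
  exact: entw_ccomul_lact.
move: c; apply: (tens_ext (M := kright A) (N := kleft D)) => [u v|u v|x d].
- by rewrite (comulD u v : entw_ccomul (u + v) = _) (tliftD LB).
- by rewrite (comulD u v : entw_ccomul (u + v) = _) (tliftD RB).
rewrite [X in tlift X]entw_ccomulE /entw_comul_pure.
rewrite (tlift_tlift _ _ LB) (tlift_tlift _ _ RB).
pose H (d1 : D) (w : (D ⊗k D)%type) : C ⊗ ltens C C :=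
  tC x d1 ⊗ (@tlift _ _ (kright D) (kleft D) _ w
    (fun d2 d3 => tC 1 d2 ⊗ tC 1 d3) : ltens C C).
have HB : bilin H.
  split=> [w|d1].
    exact: (linear_comp (@linear_tpurel _ _ C (ltens C C) _) (tC_d x)).
  apply: (linear_comp (@linear_tpurer _ _ C (ltens C C) _)).
  exact: (ktlift_linear (dd_bilin 1)).
transitivity (tlift (\tsum_(d1 ⊗ d2 <- comul D d)
   \tsum_(d11 ⊗ d12 <- comul D d1) d11 ⊗k (d12 ⊗k d2)) H).
  rewrite tlift_tlift; last exact: bilin_balanced.
  apply: eq_tlift => d1 d2; rewrite tlift_tlift; last exact: bilin_balanced.
  rewrite (tlift_pure LB) /L [X in tlift X]entw_ccomulE /entw_comul_pure.
  rewrite tlift_tlift //; apply: eq_tlift => d11 d12.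
  rewrite (tlift_pure (L1B _)) (ktlift_pure HB) /H (ktlift_pure (dd_bilin 1)).
  by [].
rewrite comulA tlift_tlift; last exact: bilin_balanced.
apply: eq_tlift => d1 d2; rewrite (tlift_pure RB) (ktlift_pure HB) /H.
by rewrite [X in _ = _ ⊗ X]entw_ccomulE.
Qed.

Lemma entw_ccounitl (c : C) :
  \tsum_(x ⊗ y <- entw_ccomul c) (entw_ccounit x ▹ y) = c.
Proof.
have LB : balanced (fun x y : C => entw_ccounit x ▹ y).
  split=> [n m m'|m n n'|m a n]; cbv beta.
  - by rewrite (epsD m m' : entw_ccounit (m + m') = _) (lactDl (N := C)).
  - by rewrite (lactDr (N := C)).
  - by rewrite entw_ccounit_ract (lactA (l := C)).
move: c; apply: (tens_ext (M := kright A) (N := kleft D)) => [u v|u v|x d].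
- by rewrite (comulD u v : entw_ccomul (u + v) = _) (tliftD LB).
- by [].
rewrite [X in tlift X]entw_ccomulE tlift_tlift //.
rewrite -[in RHS](counitl d).
rewrite (tlift_morph (g := tC x)); last exact: linear_addm (tC_d x).
apply: eq_tlift => d1 d2; rewrite (tlift_pure LB) [X in X ▹ _]entw_ccounitE.
rewrite C_lactE mulr1 (linear_scalem (tC_d x)) (linear_scalem (tC_x d2)).
by [].
Qed.

Lemma entw_ccounitr (c : C) :
  \tsum_(x ⊗ y <- entw_ccomul c) (x ◃ entw_ccounit y) = c.
Proof.
have RB : balanced (fun x y : C => x ◃ entw_ccounit y).
  split=> [n m m'|m n n'|m a n]; cbv beta.
  - by rewrite (ractDl (M := C)).
  - by rewrite (epsD n n' : entw_ccounit (n + n') = _) (ractDr (M := C)).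
  - by rewrite entw_ccounit_lact (ractA (r := C)).
move: c; apply: (tens_ext (M := kright A) (N := kleft D)) => [u v|u v|x d].
- by rewrite (comulD u v : entw_ccomul (u + v) = _) (tliftD RB).
- by [].
rewrite [X in tlift X]entw_ccomulE tlift_tlift //.
rewrite -[in RHS](counitr d).
rewrite (tlift_morph (g := tC x)); last exact: linear_addm (tC_d x).
apply: eq_tlift => d1 d2; rewrite (tlift_pure RB) [X in _ ◃ X]entw_ccounitE.
by rewrite (ractZr (M := C)) (ract1 (r := C)) (linear_scalem (tC_d x)).
Qed.

Definition entw_coring : coring A :=
  Coring entw_ccomul_lact entw_ccomul_ract entw_ccounit_lact
    entw_ccounit_ract entw_ccomulA entw_ccounitl entw_ccounitr.

Definition entw_ext_pure (x : A) (d : D) : C ⊗k D :=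
  \tsum_(d1 ⊗ d2 <- comul D d) tC x d1 ⊗k d2.
Definition entw_ext_fun (c : C) : C ⊗k D :=
  \tsum_(x ⊗ d <- c) entw_ext_pure x d.
Let ext_dd (x : A) : bilin (fun d1 d2 : D => tC x d1 ⊗k d2).
Proof.
split=> [d2|d1]; last exact: (bilin_ktpure C D).2.
exact: (linear_comp ((bilin_ktpure C D).1 d2) (tC_d x)).
Qed.
Let ext_pureB : bilin entw_ext_pure.
Proof.
split=> [d|x].
  apply: linear_inner => d1 d2.
  exact: (linear_comp ((bilin_ktpure C D).1 d2) (tC_x d1)).
exact: (linear_comp (ktlift_linear (ext_dd x)) (linear_of (comul D))).
Qed.
Lemma entw_ext_linear : linear entw_ext_fun.
Proof. exact: (ktlift_linear ext_pureB). Qed.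
Let extD := linear_addm entw_ext_linear.
Lemma entw_extE x d : entw_ext_fun (tC x d) = entw_ext_pure x d.
Proof. exact: (ktlift_pure ext_pureB). Qed.
Definition entw_ext_coact : {linear C -> (C ⊗k D)%type} :=
  HB.pack entw_ext_fun
    (GRing.isLinear.Build k C (C ⊗k D)%type *:%R _ entw_ext_linear).

Lemma entw_ext_coactA (c : C) :
  \tsum_(x ⊗ d <- entw_ext_coact c) \tsum_(x1 ⊗ x2 <- entw_ext_coact x)
    x1 ⊗k (x2 ⊗k d) = \tsum_(x ⊗ d <- entw_ext_coact c) x ⊗k comul D d.
Proof.
have L1B (d : D) : bilin (fun (x1 : C) (x2 : D) => x1 ⊗k (x2 ⊗k d)).
  split=> [x2|x1]; first exact: (bilin_ktpure C _).1.
  apply: (linear_comp (g := fun w : (D ⊗k D)%type => x1 ⊗k w)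
    (f := fun x2 : D => x2 ⊗k d)).
    exact: (bilin_ktpure C (D ⊗k D)%type).2.
  exact: (bilin_ktpure D D).1.
have LB : bilin (fun (x : C) (d : D) =>
    tlift (entw_ext_coact x) (fun (x1 : C) (x2 : D) => x1 ⊗k (x2 ⊗k d))).
  split=> [d|x].
    exact: (linear_comp (ktlift_linear (L1B d)) entw_ext_linear).
  apply: linear_inner => x1 x2.
  exact: (linear_comp ((bilin_ktpure C (D ⊗k D)%type).2 x1) ((bilin_ktpure D D).2 x2)).
have RB : bilin (fun (x : C) (d : D) => x ⊗k comul D d).
  split=> [d|x]; first exact: (bilin_ktpure C _).1.
  exact: (linear_comp ((bilin_ktpure C (D ⊗k D)%type).2 x) (linear_of (comul D))).
move: c; apply: (tens_ext (M := kright A) (N := kleft D)) => [u v|u v|x d].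
- rewrite (extD u v : entw_ext_coact (u + v) = _).
  exact: (tliftD (bilin_balanced LB)).
- rewrite (extD u v : entw_ext_coact (u + v) = _).
  exact: (tliftD (bilin_balanced RB)).
rewrite [X in tlift X]entw_extE /entw_ext_pure.
rewrite (tlift_tlift _ _ (bilin_balanced LB)) (tlift_tlift _ _ (bilin_balanced RB)).
pose H (d1 : D) (w : (D ⊗k D)%type) := tC x d1 ⊗k w.
have HB : bilin H.
  split=> [w|d1]; last exact: (bilin_ktpure C _).2.
  exact: (linear_comp ((bilin_ktpure C (D ⊗k D)%type).1 w) (tC_d x)).
transitivity (tlift (\tsum_(d1 ⊗ d2 <- comul D d)
   \tsum_(d11 ⊗ d12 <- comul D d1) d11 ⊗k (d12 ⊗k d2)) H).
  rewrite tlift_tlift; last exact: bilin_balanced.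
  apply: eq_tlift => d1 d2; rewrite tlift_tlift; last exact: bilin_balanced.
  rewrite (ktlift_pure LB) [X in tlift X]entw_extE /entw_ext_pure.
  rewrite tlift_tlift; last exact: bilin_balanced.
  by apply: eq_tlift => d11 d12; rewrite (ktlift_pure (L1B _)) (ktlift_pure HB).
rewrite comulA tlift_tlift; last exact: bilin_balanced.
by apply: eq_tlift => d1 d2; rewrite (ktlift_pure RB) (ktlift_pure HB).
Qed.

Lemma entw_ext_counit (c : C) :
  \tsum_(x ⊗ d <- entw_ext_coact c) counit D d *: x = c.
Proof.
have RB : bilin (fun (x : C) (d : D) => counit D d *: x).
  split=> [d|x] c' u v; first by rewrite scalerDr !scalerA mulrC.
  by rewrite linearP scalerDl scalerA.
move: c; apply: (tens_ext (M := kright A) (N := kleft D)) => [u v|u v|x d].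
- rewrite (extD u v : entw_ext_coact (u + v) = _).
  exact: (tliftD (bilin_balanced RB)).
- by [].
rewrite [X in tlift X]entw_extE /entw_ext_pure.
rewrite (tlift_tlift _ _ (bilin_balanced RB)) -[in RHS](counitr d).
rewrite (tlift_morph (g := tC x)); last exact: linear_addm (tC_d x).
apply: eq_tlift => d1 d2; rewrite (ktlift_pure RB) (linear_scalem (tC_d x)).
by [].
Qed.

Definition entw_ext_dcomod : dcomod D C :=
  DComod entw_ext_coactA entw_ext_counit.

Lemma entw_ext_lact a (c : C) :
  entw_ext_dcomod (a ▹ c) = \tsum_(x ⊗ d <- entw_ext_dcomod c) (a ▹ x) ⊗k d.
Proof.
have B : bilin (fun (x : C) (d : D) => (a ▹ x) ⊗k d).
  split=> [d|x]; last exact: (bilin_ktpure C D).2.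
  exact: (linear_comp ((bilin_ktpure C D).1 d) (@lact_linearr _ _ C a)).
move: c; apply: (tens_ext (M := kright A) (N := kleft D)) => [u v|u v|x d].
- by rewrite (lactDr (N := C)); apply: extD.
- rewrite (extD u v : entw_ext_dcomod (u + v) = _).
  exact: (tliftD (bilin_balanced B)).
rewrite [_ ▹ _]C_lactE [LHS]entw_extE [X in tlift X]entw_extE /entw_ext_pure.
rewrite tlift_tlift; last exact: bilin_balanced.
by apply: eq_tlift => d1 d2; rewrite (ktlift_pure B) C_lactE.
Qed.

Lemma entw_ext_colinear (c : C) :
  \tsum_(x ⊗ d <- entw_ext_dcomod c) \tsum_(x1 ⊗ x2 <- entw_ccomul x)
    x1 ⊗ (x2 ⊗k d : ltens (kbi C) (kleft D)) =
  \tsum_(x ⊗ y <- entw_ccomul c)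
    x ⊗ (entw_ext_dcomod y : ltens (kbi C) (kleft D)).
Proof.
pose E := ltens (kbi C) (kleft D).
have L1B (d : D) : balanced (fun x1 x2 : C => x1 ⊗ (x2 ⊗k d : E)).
  apply: (@balanced_tmapr _ _ C C E (fun x2 : C => x2 ⊗k d)) => [u v|b u].
    exact: (linear_addm ((bilin_ktpure C D).1 d)).
  by rewrite [RHS](@ltens_act_pure _ _ _ (kbi C) (kleft D)).
have LB : bilin (fun (x : C) (d : D) =>
    tlift (entw_ccomul x) (fun x1 x2 : C => x1 ⊗ (x2 ⊗k d : E))).
  split=> [d|x].
    apply: (linear_comp (g := fun t => tlift t (fun x1 x2 : C => x1 ⊗ (x2 ⊗k d : E))) _ entw_ccomul_linear).
    by apply: tlift_linear => // c' m n; rewrite tpureZl.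
  apply: linear_inner => x1 x2.
  exact: (linear_comp (@linear_tpurer _ _ C E x1) ((bilin_ktpure C D).2 x2)).
have RB : balanced (fun x y : C => x ⊗ (entw_ext_dcomod y : E)).
  apply: (@balanced_tmapr _ _ C C E entw_ext_dcomod) => [u v|b u].
    exact: extD.
  exact: entw_ext_lact.
move: c; apply: (tens_ext (M := kright A) (N := kleft D)) => [u v|u v|x d].
- rewrite (extD u v : entw_ext_dcomod (u + v) = _).
  exact: (tliftD (bilin_balanced LB)).
- by rewrite (comulD u v : entw_ccomul (u + v) = _) (tliftD RB).
rewrite [X in tlift X]entw_extE [X in _ = tlift X _]entw_ccomulE.
rewrite /entw_ext_pure /entw_comul_pure.
rewrite (tlift_tlift _ _ (bilin_balanced LB)) (tlift_tlift _ _ RB).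
pose H (d1 : D) (w : (D ⊗k D)%type) : C ⊗ E :=
  tC x d1 ⊗ (@tlift _ _ (kright D) (kleft D) _ w
    (fun d2 d3 => tC 1 d2 ⊗k d3) : E).
have HB : bilin H.
  split=> [w|d1].
    exact: (linear_comp (@linear_tpurel _ _ C E _) (tC_d x)).
  apply: (linear_comp (@linear_tpurer _ _ C E _)).
  exact: (ktlift_linear (ext_dd 1)).
transitivity (tlift (\tsum_(d1 ⊗ d2 <- comul D d)
   \tsum_(d11 ⊗ d12 <- comul D d1) d11 ⊗k (d12 ⊗k d2)) H).
  rewrite tlift_tlift; last exact: bilin_balanced.
  apply: eq_tlift => d1 d2; rewrite tlift_tlift; last exact: bilin_balanced.
  rewrite (ktlift_pure LB) [X in tlift X]entw_ccomulE /entw_comul_pure.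
  rewrite tlift_tlift //; apply: eq_tlift => d11 d12.
  rewrite (tlift_pure (L1B _)) (ktlift_pure HB) /H (ktlift_pure (ext_dd 1)).
  by [].
rewrite comulA tlift_tlift; last exact: bilin_balanced.
apply: eq_tlift => d1 d2; rewrite (tlift_pure RB) (ktlift_pure HB) /H.
by rewrite [X in _ = _ ⊗ X]entw_extE.
Qed.

Definition entw_extension : right_extension entw_coring D :=
  @RightExtension k A entw_coring D entw_ext_dcomod
    entw_ext_lact entw_ext_colinear.

Record entwined_module (M : rightMod A) := EntwinedModule {
  entw_dcomod :> dcomod D M;
  entw_compat : forall (m : M) (a : A),
    entw_dcomod (m ◃ a) =
    \tsum_(x ⊗ d <- entw_dcomod m) \tsum_(a' ⊗ d' <- psi (d ⊗k a))
      ract M x a' ⊗k d'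
}.

Definition convolution (f g : D -> A) (d : D) : A :=
  \tsum_(d1 ⊗ d2 <- comul D d) f d1 * g d2.

Definition convolution_invertible (f : {linear D -> A}) : Prop :=
  exists g : {linear D -> A},
    (forall d, convolution f g d = counit D d *: (1 : A)) /\
    (forall d, convolution g f d = counit D d *: (1 : A)).

Definition cleft_entwining_via (rho : entwined_module (rregular A)) : Prop :=
  exists lambda : {linear D -> A},
    colinear_from rho lambda /\ convolution_invertible lambda.

Definition cleft_entwining : Prop :=
  exists rho : entwined_module (rregular A), cleft_entwining_via rho.

End Entwining.

(* Main.v *)
Require Import Defs.
From mathcomp Require Import all_boot all_order all_algebra.
From HB Require Import structures.

Set Implicit Arguments.
Unset Strict Implicit.
Unset Printing Implicit Defensive.

Import GRing.Theory.
Local Open Scope ring_scope.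

(** For [C = A ⊗ D] and the regular module, [A ⊗_A C] is just [C], so a
    C-coaction [rhoC] on [A] carries the same information as the D-coaction
    [rhoD a = collapse (rhoC a)] with values in [A ⊗ D], and this is the induced
    one ([induced_coactE]).  Coassociativity also matches, because
    [C ⊗_A C] is [A ⊗ D ⊗ D]: over either of the two structures it says
    [rhoD 1 ⊗ rhoD m = ccomul (rhoD m)] ([dcoassocP], [ccoassocP]).

    An element [q] of Q-tilde is left A-linear in [c] and right A-linear in [x],
    hence [q (a ⊗ d) x = a * h d * x] for the single linear map
    [h d = q (1 ⊗ d) 1].  If [j] is colinear, then
    [(q • j) (a ⊗ d) = a * (h * j) (d1) ⊗ d2] and
    [(j ◊ q) d x = (j * h) d * x], where [h * j] and [j * h] are convolution
    products.  So the two conditions on [(j, q)] say exactly that [h] is a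
    convolution inverse of [j]; one direction of the equivalence is immediate.

    For the other direction, a convolution inverse [h] of a colinear [f] must
    define an element of Q-tilde, i.e. satisfy
    [psi (d1 ⊗ h d2) = h d ▹ rhoD 1].  This is automatic
    ([colinear_inverse_twists]): since [f] is colinear and [A] is entwined,
      [psi (d1 ⊗ h d2) = h d1 * f d2 ▹ psi (d3 ⊗ h d4)
                       = h d1 ▹ (rhoD (f d2) ◃ h d3)
                       = h d1 ▹ rhoD (f d2 * h d3) = h d ▹ rhoD 1]. *)

(** * Sweedler calculus for coactions *)

Section Comodule.
Variables (k : comPzRingType) (D : coalgebra k).

Definition trilin (U V W X : lmodType k) (F : U -> V -> W -> X) : Prop :=
  (forall w, bilin (fun u v => F u v w)) /\ (forall u v, linear (F u v)).

(** The usual licence to renumber Sweedler indices: coassociativity is an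
    identity in a tensor product, and [F] is what is applied to it. *)
Lemma dcoact_split3 (M W : lmodType k) (rho : dcomod D M)
    (F : M -> D -> D -> W) (m : M) : trilin F ->
  \tsum_(x ⊗ d <- rho m) \tsum_(x1 ⊗ x2 <- rho x) F x1 x2 d =
  \tsum_(x ⊗ d <- rho m) \tsum_(d1 ⊗ d2 <- comul D d) F x d1 d2.
Proof.
move=> [FB Fl].
have FxB x : bilin (F x) by split=> [d|]; [apply: (FB d).2|apply: Fl].
pose G (x : M) (w : (D ⊗k D)%type) : W := tlift w (F x).
have GB : bilin G.
  split=> [w|x]; last exact: ktlift_linear (FxB x).
  by apply: linear_inner => d1 d2; apply: (FB d2).1.
transitivity (tlift (\tsum_(x ⊗ d <- rho m) \tsum_(x1 ⊗ x2 <- rho x)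
    x1 ⊗k (x2 ⊗k d)) G).
  rewrite tlift_tlift; last exact: bilin_balanced.
  apply: eq_tlift => x d; rewrite tlift_tlift; last exact: bilin_balanced.
  by apply: eq_tlift => x1 x2; rewrite (ktlift_pure GB) /G (ktlift_pure (FxB _)).
rewrite dcoactA tlift_tlift; last exact: bilin_balanced.
by apply: eq_tlift => x d; rewrite (ktlift_pure GB).
Qed.

Lemma comul_split3 (W : lmodType k) (F : D -> D -> D -> W) (d : D) : trilin F ->
  \tsum_(x ⊗ y <- comul D d) \tsum_(x1 ⊗ x2 <- comul D x) F x1 x2 y =
  \tsum_(x ⊗ y <- comul D d) \tsum_(y1 ⊗ y2 <- comul D y) F x y1 y2.
Proof.
(* D is a comodule over itself. *)
exact: (@dcoact_split3 _ _ (DComod (@comulA k D) (@counitr k D))).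
Qed.

Lemma comul_counitl (W : lmodType k) (f : D -> W) (d : D) : linear f ->
  \tsum_(x ⊗ y <- comul D d) (counit D x *: f y) = f d.
Proof.
move=> fL; rewrite -[in RHS](counitl d).
rewrite (tlift_morph (g := f)); last exact: linear_addm.
by apply: eq_tlift => x y; rewrite (linear_scalem fL).
Qed.

Lemma comul_counitr (W : lmodType k) (f : D -> W) (d : D) : linear f ->
  \tsum_(x ⊗ y <- comul D d) (counit D y *: f x) = f d.
Proof.
move=> fL; rewrite -[in RHS](counitr d).
rewrite (tlift_morph (g := f)); last exact: linear_addm.
by apply: eq_tlift => x y; rewrite (linear_scalem fL).
Qed.

End Comodule.

(** * Tensoring with the regular module *)

Section RegularTensor.
Variables (k : comPzRingType) (A : algebra k) (N : leftMod A).

Definition collapse (t : rregular A ⊗ N) : N := \tsum_(x ⊗ n <- t) (x : A) ▹ n.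

Lemma collapse_balanced : balanced (fun (x : rregular A) (n : N) => (x : A) ▹ n).
Proof.
by split=> [n x y|x n n'|x a n]; rewrite ?lactDl ?lactDr // -lactA.
Qed.

Lemma collapse_pure (x : A) (n : N) :
  collapse ((x : rregular A) ⊗ n) = x ▹ n.
Proof. exact: tlift_pure collapse_balanced _ _. Qed.

Lemma collapse_linear : linear collapse.
Proof.
by apply: tlift_linear collapse_balanced _ => c x n; rewrite lactZl.
Qed.

Lemma collapseK (t : rregular A ⊗ N) : (1 : rregular A) ⊗ collapse t = t.
Proof.
move: t; apply: tens_ext => [u v|//|x n].
  by rewrite (linear_addm collapse_linear) tpureDr.
by rewrite collapse_pure -tpureA /= mul1r.
Qed.

(** Evaluating a balanced map on [A ⊗_A N] thus needs no decomposition: every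
    tensor is [1 ⊗ n] for one [n]. *)
Lemma tlift_collapse (P : zmodType) (f : A -> N -> P) (t : rregular A ⊗ N) :
  balanced (M := rregular A) f -> tlift t f = f 1 (collapse t).
Proof. by move=> fB; rewrite -{1}(collapseK t) (tlift_pure fB). Qed.

End RegularTensor.

(** * The coring of an entwining structure and the induced coaction *)

Section Entwined.
Variables (k : comPzRingType) (A : algebra k) (D : coalgebra k).
Variable psi : entwining A D.
Local Notation C := (entw_bimod psi).
Local Notation K := (entw_extension psi).
Local Notation tC := (fun (x : A) (d : D) => (x ⊗k d : C)).

Lemma tC_bilin : bilin tC.
Proof. exact: (bilin_ktpure A D). Qed.

Lemma entw_ext_pureE (x : A) (d : D) :
  K (tC x d) = \tsum_(d1 ⊗ d2 <- comul D d) tC x d1 ⊗k d2.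
Proof. exact: entw_extE. Qed.

Lemma entw_comulE (x : A) (d : D) :
  ccomul (entw_coring psi) (tC x d) =
    \tsum_(d1 ⊗ d2 <- comul D d) tC x d1 ⊗ tC 1 d2.
Proof. exact: entw_ccomulE. Qed.

Lemma entw_counitE (x : A) (d : D) :
  ccounit (entw_coring psi) (tC x d) = counit D d *: x.
Proof. exact: entw_ccounitE. Qed.

Lemma entw_extBr (x : A) :
   bilin (fun (c : C) (d : D) => (x * ccounit (entw_coring psi) c) ⊗k d).
Proof.
split=> [d|c]; last exact: (bilin_ktpure A D).2.
apply: (linear_comp ((bilin_ktpure A D).1 d)).
exact: (linear_comp (alg_mul_linearr x) (linear_of (ccounit (entw_coring psi)))).
Qed.

Lemma entw_ext_counitl (x : A) (c : C) :
  \tsum_(y ⊗ d <- K c) (x * ccounit (entw_coring psi) y) ⊗k d = x ▹ c.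
Proof.
have B := entw_extBr x.
move: c; apply: (tens_ext (M := kright A) (N := kleft D)) => [u v|u v|y d].
- rewrite (linear_addm (linear_of K) u v : K (u + v) = _).
  exact: (tliftD (bilin_balanced B)).
- exact: (lactDr (N := C)).
rewrite [X in tlift X]entw_ext_pureE tlift_tlift; last exact: bilin_balanced.
rewrite [RHS]C_lactE.
rewrite -[RHS](@comul_counitl _ D _ (tC (x * y)) d (tC_bilin.2 _)).
apply: eq_tlift => d1 d2; rewrite (ktlift_pure B) [X in _ * X]entw_counitE.
by rewrite -algZAr (linear_scalem (tC_bilin.1 d2)).
Qed.

Variable rhoC : ccomod (entw_coring psi) (rregular A).

Lemma induced_coactE (a : rregular A) :
  induced_coact K rhoC a = collapse (rhoC a) :> C.
Proof. by apply: eq_tlift => x c; exact: entw_ext_counitl. Qed.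

(** * Convolution inverses of colinear maps *)

Section Cleft.
Variable rhoD : entwined_module psi (rregular A).
Hypothesis rhoDC : forall a : A, rhoD a = collapse (rhoC a) :> C.

Lemma entwM (a b : A) : rhoD (a * b) = (rhoD a : C) ◃ b :> C.
Proof. exact: (@entw_compat _ _ _ _ _ rhoD a b). Qed.

Lemma convolution_linear (f g : {linear D -> A}) : linear (convolution f g).
Proof.
have B : bilin (fun d1 d2 : D => f d1 * g d2).
  split=> [v|u].
    exact: (linear_comp (alg_mul_linearl (g v)) (linear_of f)).
  exact: (linear_comp (alg_mul_linearr (f u)) (linear_of g)).
exact: (linear_comp (ktlift_linear B) (linear_of (comul D))).
Qed.

(** In Sweedler notation this is [psi (d1 ⊗ h d2)], since
    [(1 ⊗ d) ◃ a = psi (d ⊗ a)] in the coring. *)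
Definition slide (h : D -> A) (d : D) : C :=
  \tsum_(d1 ⊗ d2 <- comul D d) (tC 1 d1 ◃ h d2).

Lemma slide_linear (h : {linear D -> A}) : linear (slide h).
Proof.
have B : bilin (fun d1 d2 : D => tC 1 d1 ◃ h d2).
  split=> [d2|d1].
    exact: (linear_comp (@ract_linearl _ _ C (h d2)) (tC_bilin.2 1)).
  exact: (linear_comp (@ract_linearr _ _ C (tC 1 d1)) (linear_of h)).
exact: (linear_comp (ktlift_linear B) (linear_of (comul D))).
Qed.

(** This is what the defining identity of Q-tilde says on the
    elements [1 ⊗ d] and [1], when [h d] stands for [q (1 ⊗ d) 1]. *)
Definition twists (h : D -> A) : Prop :=
  forall d : D, slide h d = h d ▹ (rhoD 1 : C).

(** Colinearity turns [f d1 ⊗ d2] into [rhoD (f d)], and the entwined module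
    condition moves the action of [h] inside [rhoD]. *)
Lemma colinear_slide (f h : {linear D -> A}) (d : D) :
  colinear_from rhoD f ->
  \tsum_(d1 ⊗ d2 <- comul D d) (f d1 ▹ slide h d2) =
    (rhoD (convolution f h d) : C).
Proof.
move=> f_col.
transitivity (\tsum_(d1 ⊗ d2 <- comul D d) \tsum_(e1 ⊗ e2 <- comul D d2)
    (tC (f d1) e1 ◃ h e2)).
  apply: eq_tlift => d1 d2.
  rewrite (tlift_morph (g := fun c : C => f d1 ▹ c)); last first.
    exact: (lactDr (N := C)).
  apply: eq_tlift => e1 e2.
  by rewrite [LHS]blact_ract [X in X ◃ _]C_lactE mulr1.
rewrite -(@comul_split3 _ D _ (fun a b c => tC (f a) b ◃ h c)); last first.
  split=> [c|a b]; last first.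
    exact: (linear_comp (@ract_linearr _ _ C (tC (f a) b)) (linear_of h)).
  split=> [b|a]; apply: (linear_comp (@ract_linearl _ _ C (h c))).
    exact: (linear_comp (tC_bilin.1 b) (linear_of f)).
  exact: tC_bilin.2.
rewrite [RHS](tlift_morph (g := rhoD)); last exact: linear_addm (linear_of rhoD).
apply: eq_tlift => d1 d2; rewrite [RHS]entwM f_col.
rewrite [RHS](tlift_morph (g := fun c : C => c ◃ h d2)) //.
exact: (fun u v => ractDl (M := C) u v (h d2)).
Qed.

(** Insert [h d1 * f d2 = eps d *: 1] in front of [slide h]; by
    [colinear_slide] the factor [f] is then absorbed into
    [rhoD (convolution f h)], which is a multiple of [rhoD 1]. *)
Lemma colinear_inverse_twists (f h : {linear D -> A}) :
  colinear_from rhoD f ->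
  (forall d, convolution f h d = counit D d *: (1 : A)) ->
  (forall d, convolution h f d = counit D d *: (1 : A)) ->
  twists h.
Proof.
move=> f_col fh hf d.
have actL a : linear (fun c : C => a ▹ c) by apply: (@lact_linearr _ _ C).
have actl c : linear (fun a : A => a ▹ (c : C)) by apply: (@lact_linearl _ _ C).
transitivity (\tsum_(x ⊗ y <- comul D d) \tsum_(x1 ⊗ x2 <- comul D x)
    ((h x1 * f x2) ▹ slide h y)).
  rewrite -[LHS](@comul_counitl _ D _ (slide h) d (slide_linear h)).
  apply: eq_tlift => x y.
  rewrite -(tlift_morph (g := fun a : A => a ▹ slide h y)); last first.
    exact: linear_addm (actl _).
  by rewrite [X in X ▹ _]hf (linear_scalem (actl _)) (@lact1 _ _ C).
rewrite (@comul_split3 _ D _ (fun a b c => (h a * f b) ▹ slide h c)); last first.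
  split=> [c|a b]; last exact: (linear_comp (actL _) (slide_linear h)).
  split=> [b|a]; apply: (linear_comp (actl _)).
    exact: (linear_comp (alg_mul_linearl (f b)) (linear_of h)).
  exact: (linear_comp (alg_mul_linearr (h a)) (linear_of f)).
rewrite -[RHS](@comul_counitr _ D _ (fun a => h a ▹ (rhoD 1 : C)) d); last first.
  exact: (linear_comp (actl _) (linear_of h)).
apply: eq_tlift => x y.
rewrite -(linear_scalem (actL (h x))).
have <- : (rhoD (convolution f h y) : C) = counit D y *: (rhoD 1 : C).
  by rewrite fh (linear_scalem (linear_of rhoD)).
rewrite -colinear_slide // (tlift_morph (g := fun c : C => h x ▹ c)); last first.
  exact: (lactDr (N := C)).
by apply: eq_tlift => y1 y2; rewrite (@lactA _ _ C).
Qed.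

(** * Q-tilde for the regular comodule *)

(** By linearity on both sides, the only candidate for an element of Q-tilde
    with [q (1 ⊗ d) 1 = h d]. *)
Definition qext (h : D -> A) (c : C) (x : A) : A :=
  \tsum_(a ⊗ d <- c) (a * h d * x).

Section QtildeExt.
Variables (h : {linear D -> A}) (h_tw : twists h).

Lemma qext_bilin (x : A) : bilin (fun (a : A) (d : D) => a * h d * x).
Proof.
split=> [d|a]; apply: (linear_comp (alg_mul_linearl x)).
  exact: alg_mul_linearl.
exact: (linear_comp (alg_mul_linearr a) (linear_of h)).
Qed.

Lemma qext_pure (a : A) (d : D) (x : A) : qext h (tC a d) x = a * h d * x.
Proof. exact: (ktlift_pure (qext_bilin x)). Qed.

Lemma qext_linearl (x : A) : linear (qext h ^~ x).
Proof. exact: (ktlift_linear (qext_bilin x)). Qed.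

Lemma qext_linearr (c : C) : linear (qext h c).
Proof. by apply: linear_inner => a d; apply: alg_mul_linearr. Qed.

Lemma qext_ract (c : C) (x : rregular A) (a : A) :
  qext h c (x ◃ a) = qext h c x * a.
Proof.
rewrite /qext [RHS](tlift_morph (g := fun z : A => z * a)); last first.
  by move=> u v; apply: mulrDl.
by apply: eq_tlift => b d; rewrite mulrA.
Qed.

Lemma qext_lact (a : A) (c : C) (x : A) :
  qext h (a ▹ c) x = a * qext h c x.
Proof.
move: c; apply: (tens_ext (M := kright A) (N := kleft D)) => [u v|u v|b d].
- by rewrite (lactDr (N := C)); apply: linear_addm (qext_linearl x) _ _.
- by rewrite (linear_addm (qext_linearl x) u v : qext h (u + v) x = _) mulrDr.
by rewrite [X in qext h X]C_lactE [LHS]qext_pure [X in _ = _ * X]qext_pure !mulrA.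
Qed.

(** Both sides are left A-linear in [c] and right A-linear in [x], by [entwM],
    so the identity reduces to [c = 1 ⊗ d] and [x = 1], where it is [h_tw]. *)
Lemma qext_comul (c : C) (x : rregular A) :
  \tsum_(c1 ⊗ c2 <- ccomul (entw_coring psi) c) (c1 ◃ qext h c2 x) =
  \tsum_(x0 ⊗ x1 <- rhoC x) (qext h c x0 ▹ x1).
Proof.
have LB : balanced (fun c1 c2 : C => c1 ◃ qext h c2 x).
  split=> [n m m'|m n n'|m a n]; cbv beta.
  - exact: (ractDl (M := C)).
  - by rewrite (linear_addm (qext_linearl x)) (ractDr (M := C)).
  - by rewrite (@ractA _ _ C) qext_lact.
rewrite (@tlift_collapse _ _ C _ (fun x0 x1 => qext h c x0 ▹ x1)); last first.
  split=> [n m m'|m n n'|m a n]; cbv beta.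
  - by rewrite (linear_addm (qext_linearr c)) (lactDl (N := C)).
  - exact: (lactDr (N := C)).
  - by rewrite [qext _ _ _]qext_ract -(@lactA _ _ C).
rewrite -rhoDC.
move: c; apply: (tens_ext (M := kright A) (N := kleft D)) => [u v|u v|a d].
- rewrite (linear_addm (linear_of (ccomul (entw_coring psi))) u v :
    ccomul (entw_coring psi) (u + v) = _).
  exact: (tliftD LB).
- rewrite (linear_addm (qext_linearl 1) u v : qext h (u + v) 1 = _).
  exact: (lactDl (N := C)).
rewrite [X in tlift X]entw_comulE tlift_tlift //.
rewrite [X in X ▹ _]qext_pure mulr1 -[x in RHS]mul1r entwM.
rewrite -[RHS](@lactA _ _ C) [X in _ = _ ▹ X](@blact_ract _ _ _ C).
rewrite [RHS](@blact_ract _ _ _ C) -[X in _ = _ ▹ X ◃ _]h_tw.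
rewrite (tlift_morph (g := fun c : C => a ▹ c)); last exact: (lactDr (N := C)).
rewrite (tlift_morph (g := fun c : C => c ◃ x)); last first.
  by move=> u v; apply: (ractDl (M := C)).
apply: eq_tlift => d1 d2; rewrite (tlift_pure LB) qext_pure mul1r.
rewrite [X in _ = X ◃ _](@blact_ract _ _ _ C) [X in _ = X ◃ _ ◃ _]C_lactE.
by rewrite mulr1 (@ractA _ _ C).
Qed.

Definition Qtilde_from : Qtilde rhoC :=
  @MkQtilde k A (entw_coring psi) (rregular A) rhoC (qext h)
    qext_linearl qext_linearr qext_ract qext_lact qext_comul.

End QtildeExt.

(** * The two cleftness conditions as convolution identities *)

Section QtildeEval.
Variables (q : Qtilde rhoC) (h : {linear D -> A}) (j : {linear D -> A}).
Hypothesis qh : forall (a : A) (d : D) (x : A), q (tC a d) x = a * h d * x.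

Lemma qtilde_actE (c : C) (a : A) :
  \tsum_(x0 ⊗ x1 <- rhoC a) (q c x0 ▹ x1) = q c (1 : A) ▹ (rhoD a : C).
Proof.
rewrite rhoDC (@tlift_collapse _ _ C _ (fun x0 x1 => q c x0 ▹ x1)) //.
split=> [n m m'|m n n'|m b n]; cbv beta.
- by rewrite (linear_addm (@qfun_linearr _ _ _ _ _ q c)) (lactDl (N := C)).
- exact: (lactDr (N := C)).
- by rewrite qfun_ract -(@lactA _ _ C).
Qed.

(** Colinearity of [j] gives [a * h d1 ▹ rhoD (j d2) = a * h d1 * j d2 ⊗ d3];
    coassociativity then groups [d1] and [d2] into a convolution. *)
Lemma qbullet_convolution (a : A) (d : D) : colinear_from rhoD j ->
  qbullet K q j (tC a d) =
    \tsum_(d1 ⊗ d2 <- comul D d) tC (a * convolution h j d1) d2.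
Proof.
move=> j_col.
transitivity (\tsum_(c ⊗ e <- K (tC a d)) (q c (1 : A) ▹ (rhoD (j e) : C))).
  by apply: eq_tlift => c e; apply: qtilde_actE.
have B : bilin (fun (c : C) (e : D) => q c (1 : A) ▹ (rhoD (j e) : C)).
  split=> [e|c].
    exact: (linear_comp (@lact_linearl _ _ C _)
      (@qfun_linearl _ _ _ _ _ q (1 : A))).
  apply: (linear_comp (@lact_linearr _ _ C _)).
  exact: (linear_comp (linear_of rhoD) (linear_of j)).
rewrite [X in tlift X]entw_ext_pureE tlift_tlift; last exact: bilin_balanced.
transitivity (\tsum_(d1 ⊗ d2 <- comul D d) \tsum_(e1 ⊗ e2 <- comul D d2)
    tC (a * (h d1 * j e1)) e2).
  apply: eq_tlift => d1 d2; rewrite (ktlift_pure B) qh mulr1 j_col.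
  rewrite (tlift_morph (g := fun c : C => (a * h d1) ▹ c)); last first.
    exact: (lactDr (N := C)).
  by apply: eq_tlift => e1 e2; rewrite [LHS]C_lactE mulrA.
rewrite -(@comul_split3 _ D _ (fun x y z => tC (a * (h x * j y)) z)); last first.
  split=> [z|x y]; last exact: tC_bilin.2.
  split=> [y|x]; apply: (linear_comp (tC_bilin.1 z));
    apply: (linear_comp (alg_mul_linearr a)).
    exact: (linear_comp (alg_mul_linearl _) (linear_of h)).
  exact: (linear_comp (alg_mul_linearr _) (linear_of j)).
apply: eq_tlift => d1 d2.
rewrite (tlift_morph (g := fun b : A => tC (a * b) d2)) //.
apply: linear_addm; exact: (linear_comp (tC_bilin.1 d2) (alg_mul_linearr a)).
Qed.

Lemma qbullet_idP : colinear_from rhoD j ->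
  (forall c, qbullet K q j c = c) <->
  (forall d, convolution h j d = counit D d *: (1 : A)).
Proof.
move=> j_col; split=> [qj d|hj c].
  (* Applying the counit of the coring recovers the convolution product. *)
  have := qj (tC 1 d); rewrite qbullet_convolution //.
  move/(congr1 (ccounit (entw_coring psi))).
  rewrite [RHS]entw_counitE => <-.
  rewrite -[LHS](@comul_counitr _ D _ _ d (convolution_linear h j)).
  rewrite [RHS](tlift_morph (g := ccounit (entw_coring psi))); last first.
    exact: (linear_addm (linear_of (ccounit (entw_coring psi)))).
  by apply: eq_tlift => d1 d2; rewrite [RHS]entw_counitE mul1r.
move: c; apply: (tens_ext (M := kright A) (N := kleft D)) => [u v|u v|a d].
- rewrite /qbullet (linear_addm (linear_of K) u v : K (u + v) = _).
  apply: (@tliftD _ _ (kright C) (kleft D)); apply: bilin_balanced.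
  split=> [e|c].
    apply: linear_inner => x0 x1.
    exact: (linear_comp (@lact_linearl _ _ C _) (@qfun_linearl _ _ _ _ _ q _)).
  move=> b e e'; rewrite !qtilde_actE.
  rewrite (linear_of j) (linear_of rhoD); exact: (@lact_linearr _ _ C).
- by [].
rewrite [LHS]qbullet_convolution //.
rewrite -[RHS](@comul_counitl _ D _ (tC a) d (tC_bilin.2 _)).
apply: eq_tlift => d1 d2.
by rewrite hj -algZAr mulr1 (linear_scalem (tC_bilin.1 d2)).
Qed.

Lemma lozenge_convolution (d : D) (x : A) : colinear_from rhoD j ->
  lozenge (S := rregular A) j q d x = convolution j h d * x.
Proof.
move=> j_col.
have qB : bilin (fun (a : A) (e : D) => q (tC a e) x).
  split=> [e|a].
    exact: (linear_comp (@qfun_linearl _ _ _ _ _ q x) (tC_bilin.1 e)).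
  exact: (linear_comp (@qfun_linearl _ _ _ _ _ q x) (tC_bilin.2 a)).
rewrite /lozenge (@tlift_collapse _ _ C _ (fun x0 x1 => x0 * q x1 x)).
  rewrite -rhoDC j_col mul1r.
  rewrite (tlift_morph (g := fun c : C => q c x)); last first.
    exact: (linear_addm (@qfun_linearl _ _ _ _ _ q x)).
  rewrite /convolution (tlift_morph (g := fun b : A => b * x)); last first.
    by move=> u v; apply: mulrDl.
  by apply: eq_tlift => d1 d2; rewrite qh.
split=> [n m m'|m n n'|m b n]; cbv beta.
- exact: mulrDl.
- by rewrite (linear_addm (@qfun_linearl _ _ _ _ _ q x)) mulrDr.
- by rewrite qfun_lact mulrA.
Qed.

Lemma lozenge_idP : colinear_from rhoD j ->
  (forall (d : D) (x : rregular A),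
    lozenge_end (S := rregular A) j q d x = counit D d *: x) <->
  (forall d, convolution j h d = counit D d *: (1 : A)).
Proof.
move=> j_col; split=> [jq d|jh d x].
  by rewrite -jq [RHS]lozenge_convolution // mulr1.
by rewrite [LHS]lozenge_convolution // jh -algZAl mul1r.
Qed.

End QtildeEval.

Lemma Qtilde_pureE (q : Qtilde rhoC) (a : A) (d : D) (x : A) :
  q (tC a d) x = a * q (tC 1 d) (1 : A) * x.
Proof.
by rewrite -[x in LHS]mul1r [LHS]qfun_ract -[in LHS](mulr1 a) -C_lactE qfun_lact.
Qed.

Lemma Qtilde_eval_linear (q : Qtilde rhoC) :
  linear (fun d : D => q (tC 1 d) (1 : A)).
Proof.
exact: (linear_comp (@qfun_linearl _ _ _ _ _ q (1 : A)) (tC_bilin.2 1)).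
Qed.

Definition Qtilde_eval (q : Qtilde rhoC) : {linear D -> A} :=
  HB.pack (fun d : D => q (tC 1 d) (1 : A))
    (GRing.isLinear.Build k D A *:%R _ (Qtilde_eval_linear q)).

Lemma cleft_entwining_via_iff :
  cleft_entwining_via rhoD <-> cleft_bicomodule K rhoC.
Proof.
have colE (j : {linear D -> A}) :
    colinear_from rhoD j <-> colinear_from (induced_coact K rhoC) j.
  by split=> j_col d; rewrite -j_col induced_coactE rhoDC.
split=> [[j [j_col [h [jh hj]]]]|[j [q [/colE j_col qj jq]]]].
  have h_tw := colinear_inverse_twists j_col jh hj.
  exists j, (Qtilde_from h_tw); split; first exact/colE.
    exact/(@qbullet_idP (Qtilde_from h_tw) h j (qext_pure h) j_col).
  exact/(@lozenge_idP (Qtilde_from h_tw) h j (qext_pure h) j_col).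
have qh : forall a d (x : A), q (tC a d) x = a * Qtilde_eval q d * x.
  exact: Qtilde_pureE.
exists j; split=> //; exists (Qtilde_eval q); split.
  exact/(lozenge_idP qh j_col).
exact/(qbullet_idP qh j_col).
Qed.

End Cleft.
End Entwined.

(** * Coactions of the coring and of the coalgebra on the regular module *)

Section Transfer.
Variables (k : comPzRingType) (A : algebra k) (D : coalgebra k).
Variable psi : entwining A D.
Local Notation C := (entw_bimod psi).
Local Notation K := (entw_extension psi).
Local Notation tC := (fun (x : A) (d : D) => (x ⊗k d : C)).
Local Notation ADD := (A ⊗k (D ⊗k D)%type)%type.

(** The isomorphism of [A ⊗ D ⊗ D] with [C ⊗_A C]: its injectivity is what
    transports coassociativity in both directions. *)
Definition splitC (t : ADD) : C ⊗ C :=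
  \tsum_(x ⊗ w <- t) \tsum_(d1 ⊗ d2 <- w) tC x d1 ⊗ tC 1 d2.

Lemma splitC_inner (x : A) : bilin (fun d1 d2 : D => (tC x d1 ⊗ tC 1 d2 : C ⊗ C)).
Proof.
split=> [d2|d1].
  exact: (linear_comp (@linear_tpurel _ _ C C (tC 1 d2)) ((tC_bilin psi).2 x)).
exact: (linear_comp (@linear_tpurer _ _ C C (tC x d1)) ((tC_bilin psi).2 1)).
Qed.

Lemma splitC_bilin : bilin (fun (x : A) (w : (D ⊗k D)%type) =>
  \tsum_(d1 ⊗ d2 <- w) (tC x d1 ⊗ tC 1 d2 : C ⊗ C)).
Proof.
split=> [w|x]; last exact: (ktlift_linear (splitC_inner x)).
apply: linear_inner => d1 d2.
exact: (linear_comp (@linear_tpurel _ _ C C (tC 1 d2)) ((tC_bilin psi).1 d1)).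
Qed.

Lemma splitC_linear : linear splitC.
Proof. exact: (ktlift_linear splitC_bilin). Qed.

Lemma splitC_pure (x : A) (d1 d2 : D) :
  splitC (x ⊗k (d1 ⊗k d2)) = tC x d1 ⊗ tC 1 d2.
Proof. by rewrite [LHS](ktlift_pure splitC_bilin) (ktlift_pure (splitC_inner x)). Qed.

Definition appendD (c : C) (e : D) : ADD := \tsum_(x ⊗ d <- c) x ⊗k (d ⊗k e).

Lemma appendD_inner (e : D) : bilin (fun (x : A) (d : D) => x ⊗k (d ⊗k e)).
Proof.
split=> [d|x]; first exact: (bilin_ktpure A _).1.
exact: (linear_comp ((bilin_ktpure A (D ⊗k D)%type).2 x) ((bilin_ktpure D D).1 e)).
Qed.

Lemma appendD_bilin : bilin appendD.
Proof.
split=> [e|c]; first exact: (ktlift_linear (appendD_inner e)).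
apply: linear_inner => x d.
exact: (linear_comp ((bilin_ktpure A (D ⊗k D)%type).2 x) ((bilin_ktpure D D).2 d)).
Qed.

Lemma appendD_act_bilin (c : C) : bilin (fun (y : A) (e : D) => appendD (c ◃ y) e).
Proof.
split=> [e|y]; last exact: appendD_bilin.2.
exact: (linear_comp (appendD_bilin.1 e) (@ract_linearr _ _ C c)).
Qed.

(** The inverse isomorphism must move the middle scalar to the left through
    [D]: it sends [c ⊗ (y ⊗ e)] to [c ◃ y] with [e] appended. *)
Definition mergeC (c c' : C) : ADD := \tsum_(y ⊗ e <- c') appendD (c ◃ y) e.

Lemma mergeC_linearr (c : C) : linear (mergeC c).
Proof. exact: (ktlift_linear (appendD_act_bilin c)). Qed.

Lemma mergeC_balanced : balanced mergeC.
Proof.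
split=> [n m m'|m n n'|m a n].
- rewrite -tliftDf; apply: eq_tlift => y e.
  by rewrite (ractDl (M := C)) (linear_addm (appendD_bilin.1 e)).
- exact: (linear_addm (mergeC_linearr m)).
move: n; apply: (tens_ext (M := kright A) (N := kleft D)) => [u v|u v|y e].
- exact: (linear_addm (mergeC_linearr (m ◃ a)) u v).
- by rewrite (lactDr (N := C)); apply: (linear_addm (mergeC_linearr m)).
rewrite [X in _ = mergeC m X]C_lactE.
rewrite [LHS](ktlift_pure (appendD_act_bilin _)).
rewrite [RHS](ktlift_pure (appendD_act_bilin _)).
by rewrite (@ractA _ _ C).
Qed.

Lemma splitCK : cancel splitC (fun t => tlift t mergeC).
Proof.
pose F (t : C ⊗ C) : ADD := tlift t mergeC.
have FD : {morph F : u v / u + v} by apply: tliftD mergeC_balanced.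
move=> t; change (F (splitC t) = t); move: t.
apply: tens_ext => [u v|//|x w].
  by rewrite (linear_addm splitC_linear) FD.
move: w; apply: tens_ext => [u v|u v|d1 d2].
- by rewrite tpureDr (linear_addm splitC_linear) FD.
- exact: tpureDr.
rewrite [X in F X]splitC_pure [LHS](tlift_pure mergeC_balanced).
rewrite [LHS](ktlift_pure (appendD_act_bilin _)) (@ract1 _ _ C).
exact: (ktlift_pure (appendD_inner d2)).
Qed.

Section Coassoc.
Variables (rho : {linear A -> C}) (m : A).
Hypothesis rhoM : forall a b : A, rho (a * b) = rho a ◃ b.

(** As [rho x = rho 1 ◃ x], the scalar [x] of [rho m = x ⊗ d] can be moved
    across the tensor sign: [rho x ⊗ (1 ⊗ d) = rho 1 ⊗ (x ⊗ d)]. *)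
Lemma splitC_coactA :
  splitC (\tsum_(x ⊗ d <- rho m) \tsum_(x1 ⊗ x2 <- rho x) x1 ⊗k (x2 ⊗k d)) =
  rho 1 ⊗ rho m.
Proof.
have uD := linear_addm splitC_linear.
rewrite [in RHS](@tensE _ _ (kright A) (kleft D) (rho m)).
rewrite (tlift_morph (g := fun c : C => rho 1 ⊗ c)); last exact: (tpureDr (N := C)).
rewrite (tlift_morph _ _ uD); apply: eq_tlift => x d.
rewrite [X in _ ⊗ X]tC_split -(tpureA (N := C)) -rhoM mul1r.
rewrite [in RHS](@tensE _ _ (kright A) (kleft D) (rho x)).
rewrite (tlift_morph _ _ uD).
rewrite (tlift_morph (g := fun c : C => c ⊗ tC 1 d)); last first.
  by move=> u v; apply: tpureDl.
by apply: eq_tlift => x1 x2; rewrite splitC_pure.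
Qed.

Lemma splitC_comul :
  splitC (\tsum_(x ⊗ d <- rho m) x ⊗k comul D d) =
  ccomul (entw_coring psi) (rho m).
Proof.
rewrite (tlift_morph _ _ (linear_addm splitC_linear)).
by apply: eq_tlift => x d; rewrite [LHS](ktlift_pure splitC_bilin).
Qed.

Lemma dcoassocP :
  (\tsum_(x ⊗ d <- rho m) \tsum_(x1 ⊗ x2 <- rho x) x1 ⊗k (x2 ⊗k d) =
   \tsum_(x ⊗ d <- rho m) x ⊗k comul D d) <->
  rho 1 ⊗ rho m = ccomul (entw_coring psi) (rho m).
Proof.
split=> [e|]; first by rewrite -splitC_coactA e splitC_comul.
by rewrite -splitC_coactA -splitC_comul => /(can_inj splitCK).
Qed.

(* The C-coaction that corresponds to [rho] under [collapse]. *)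
Variable rhoC : rregular A -> rregular A ⊗ C.
Hypothesis rhoCE : forall a : A, rhoC a = (1 : rregular A) ⊗ rho a.

Lemma ccoassocP :
  (\tsum_(x ⊗ c <- rhoC m) \tsum_(x1 ⊗ x2 <- rhoC x) x1 ⊗ (x2 ⊗ c) =
   \tsum_(x ⊗ c <- rhoC m) x ⊗ ccomul (entw_coring psi) c) <->
  rho 1 ⊗ rho m = ccomul (entw_coring psi) (rho m).
Proof.
have xcB (c : C) :
    balanced (fun (x1 : rregular A) (x2 : C) => x1 ⊗ (x2 ⊗ c : ltens C C)).
  apply: (@balanced_tmapr _ _ (rregular A) C (ltens C C)
    (fun x2 : C => x2 ⊗ c)) => [u v|b u].
    exact: tpureDl.
  by rewrite [RHS]ltens_act_pure.
have LB : balanced (fun (x : rregular A) (c : C) =>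
    (1 : rregular A) ⊗ (rho x ⊗ c : ltens C C)).
  split=> [n x y|x n n'|x a n]; cbv beta.
  - by rewrite (linear_addm (linear_of rho)) tpureDl (tpureDr (N := ltens C C)).
  - by rewrite (tpureDr (N := C)) (tpureDr (N := ltens C C)).
  - by rewrite rhoM (tpureA (N := C)).
have RB : balanced (fun (x : rregular A) (c : C) =>
    x ⊗ (ccomul (entw_coring psi) c : ltens C C)).
  apply: (@balanced_tmapr _ _ (rregular A) C (ltens C C)
    (ccomul (entw_coring psi))) => [u v|b u].
    exact: (linear_addm (linear_of (ccomul (entw_coring psi)))).
  exact: entw_ccomul_lact.
have -> : \tsum_(x ⊗ c <- rhoC m) \tsum_(x1 ⊗ x2 <- rhoC x)
      x1 ⊗ (x2 ⊗ c : ltens C C) =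
    (1 : rregular A) ⊗ (rho 1 ⊗ rho m : ltens C C).
  rewrite -[RHS](tlift_pure LB (1 : A) (rho m)) -rhoCE; apply: eq_tlift => x c.
  by rewrite rhoCE (tlift_pure (xcB c)).
rewrite rhoCE (tlift_pure RB); split=> [|-> //].
move/(congr1 (@collapse _ _ (ltens C C))).
by rewrite !collapse_pure !(@lact1 _ _ (ltens C C)).
Qed.

End Coassoc.

Section ToCComod.
Variable rhoD : entwined_module psi (rregular A).

Definition ccoact_fun (a : rregular A) : rregular A ⊗ C :=
  (1 : rregular A) ⊗ (rhoD a : C).

Lemma ccoact_linear : linear ccoact_fun.
Proof.
exact: (linear_comp (@linear_tpurer _ _ (rregular A) C (1 : A)) (linear_of rhoD)).
Qed.

Definition ccoact_lin : {linear rregular A -> (rregular A ⊗ C)%type} :=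
  HB.pack ccoact_fun (GRing.isLinear.Build k (rregular A) (rregular A ⊗ C)%type
    *:%R _ ccoact_linear).

Lemma ccoact_lin_ract (m : rregular A) (a : A) :
  ccoact_lin (m ◃ a) = \tsum_(x ⊗ c <- ccoact_lin m) x ⊗ (c ◃ a).
Proof.
rewrite (@tlift_pure _ _ (rregular A) C _ (fun x c => x ⊗ (c ◃ a))).
  by congr (_ ⊗ _); apply: entwM.
apply: (@balanced_tmapr _ _ (rregular A) C C (fun c : C => c ◃ a)) => [u v|b u].
  exact: (ractDl (M := C)).
by rewrite [RHS](@blact_ract _ _ _ C).
Qed.

Lemma ccoact_linA (m : rregular A) :
  \tsum_(x ⊗ c <- ccoact_lin m) \tsum_(x1 ⊗ x2 <- ccoact_lin x) x1 ⊗ (x2 ⊗ c) =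
  \tsum_(x ⊗ c <- ccoact_lin m) x ⊗ ccomul (entw_coring psi) c.
Proof.
apply/(@ccoassocP rhoD m (entwM rhoD) ccoact_lin (fun=> erefl)).
exact/(dcoassocP m (entwM rhoD))/dcoactA.
Qed.

Lemma ccoact_lin_counit (m : rregular A) :
  \tsum_(x ⊗ c <- ccoact_lin m) (x ◃ ccounit (entw_coring psi) c) = m.
Proof.
rewrite (@tlift_pure _ _ (rregular A) C _
  (fun x c => x ◃ ccounit (entw_coring psi) c)).
  by rewrite [LHS]mul1r; apply: dcoact_counit.
split=> [c x y|x c c'|x a c]; cbv beta.
- exact: (ractDl (M := rregular A)).
- rewrite (linear_addm (linear_of (ccounit (entw_coring psi)))).
  exact: (ractDr (M := rregular A)).
- by rewrite [X in _ = _ ◃ X]ccounit_lact (@ractA _ _ (rregular A)).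
Qed.

Definition ccomod_of_entwined : ccomod (entw_coring psi) (rregular A) :=
  @CComod k A (entw_coring psi) (rregular A) ccoact_lin
    ccoact_lin_ract ccoact_linA ccoact_lin_counit.

Lemma ccomod_of_entwinedE (a : A) :
  rhoD a = collapse (ccomod_of_entwined a) :> C.
Proof. by rewrite [RHS]collapse_pure (@lact1 _ _ C). Qed.

End ToCComod.

Section ToEntwined.
Variable rhoC : ccomod (entw_coring psi) (rregular A).

Definition dcoact_fun (a : A) : A ⊗k D := collapse (rhoC a).

Lemma dcoact_linear : linear dcoact_fun.
Proof. exact: (linear_comp (@collapse_linear _ _ C) (linear_of rhoC)). Qed.

Definition dcoact_lin : {linear A -> (A ⊗k D)%type} :=
  HB.pack dcoact_fun (GRing.isLinear.Build k A (A ⊗k D)%type *:%R _ dcoact_linear).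

Lemma dcoact_linM (a b : A) : dcoact_lin (a * b) = (dcoact_lin a : C) ◃ b.
Proof.
rewrite [LHS](congr1 (@collapse _ _ C) (ccoact_ract rhoC a b)).
rewrite (tlift_morph (g := @collapse _ _ C)); last first.
  exact: (linear_addm (@collapse_linear _ _ C)).
rewrite [RHS](tlift_morph (g := fun c : C => c ◃ b)); last first.
  by move=> u v; apply: (ractDl (M := C)).
by apply: eq_tlift => x c; rewrite [LHS]collapse_pure [LHS](@blact_ract _ _ _ C).
Qed.

Lemma dcoact_linA (m : A) :
  \tsum_(x ⊗ d <- dcoact_lin m) \tsum_(x1 ⊗ x2 <- dcoact_lin x) x1 ⊗k (x2 ⊗k d) =
  \tsum_(x ⊗ d <- dcoact_lin m) x ⊗k comul D d.
Proof.
apply/(@dcoassocP dcoact_lin m dcoact_linM).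
apply/(@ccoassocP dcoact_lin m dcoact_linM rhoC).
  by move=> a; rewrite [RHS]collapseK.
exact: (@ccoactA _ _ _ _ rhoC m).
Qed.

Lemma dcoact_lin_counit (m : A) :
  \tsum_(x ⊗ d <- dcoact_lin m) (counit D d *: x) = m.
Proof.
rewrite -[RHS](ccoact_counit rhoC m).
rewrite (@tlift_collapse _ _ C _ (fun x c => x * ccounit (entw_coring psi) c)).
  by rewrite mul1r.
split=> [c x y|x c c'|x a c]; cbv beta.
- exact: mulrDl.
- by rewrite (linear_addm (linear_of (ccounit (entw_coring psi)))) mulrDr.
- by rewrite [X in _ = _ * X]ccounit_lact mulrA.
Qed.

Definition entwined_of_ccomod : entwined_module psi (rregular A) :=
  @EntwinedModule k A D psi (rregular A)
    (@DComod k D A dcoact_lin dcoact_linA dcoact_lin_counit) dcoact_linM.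

End ToEntwined.
End Transfer.

Theorem proposition6p2 (k : comPzRingType) (A : algebra k) (D : coalgebra k)
    (psi : entwining A D) :
  (cleft_entwining psi <-> regular_cleft_bicomodule (entw_extension psi)) /\
  (forall (rhoD : entwined_module psi (rregular A))
      (rhoC : ccomod (entw_coring psi) (rregular A)),
    (forall a : rregular A,
       rhoD a = induced_coact (entw_extension psi) rhoC a) ->
    (cleft_entwining_via rhoD <->
     cleft_bicomodule (entw_extension psi) rhoC)).
Proof.
split; last first.
  move=> rhoD rhoC rhoDC; apply: cleft_entwining_via_iff => a.
  by rewrite rhoDC induced_coactE.
split=> [[rhoD]|[rhoC]].
  move/(cleft_entwining_via_iff (ccomod_of_entwinedE rhoD)).
  by exists (ccomod_of_entwined rhoD).
have E (a : A) : entwined_of_ccomod rhoC a = collapse (rhoC a) by [].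
by move/(cleft_entwining_via_iff E); exists (entwined_of_ccomod rhoC).
Qed.
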